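(* Let $K=\mathbb C$, let $V$ be an $n$-dimensional $K$-vector space and $G\leqslant\mathrm{GL}(V)$ a finite group generated by pseudo-reflections. Let $\varphi:S\otimes_RS\to\mathrm{Maps}(G,S)$ be given by $\varphi(\sum_i a_i\otimes b_i)(g)=\sum_i a_i\,g(b_i)$, and consider the map $\psi:\mathrm{Maps}(G,S)\to S\otimes_RS$ given by $$\psi\big((s_g)_{g\in G}\big)=\sum_{g\in G}s_g\,\det\!\big(\nabla_i^j(g(\mathbf x'),\mathbf x'')\big).$$ This map is $S$-linear on the left and $\varphi\psi=J\,\mathrm{id}_{\mathrm{Maps}(G,S)}$. As both $\mathrm{Maps}(G,S)$ and $S\otimes_RS$ are free (left) $S$-modules, the pair $(\varphi,\psi)$ constitutes a matrix factorization of $J\in S$ whose cokernel is $\overline A=A/AeA$ as left $S$-module. In particular, $\overline A$ is a maximal Cohen--Macaulay module over the hypersurface ring $S/(J)$.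
   Context: $S=\mathrm{Sym}_K(V)=K[x_1,\dots,x_n]$ with $G$ acting by algebra automorphisms extending its action on $V$ (for $s=f(\mathbf x)$, $g(s)=f(g\mathbf x)$). A pseudo-reflection is an element of $\mathrm{GL}(V)$ conjugate to $\mathrm{diag}(\zeta,1,\dots,1)$ with $\zeta\ne1$ a root of unity. $R=S^G=K[f_1,\dots,f_n]$ with homogeneous basic invariants $f_i$, and $J=\det(\partial f_i/\partial x_j)$. In $S\otimes_KS$ write $x_i'=x_i\otimes1$, $x_i''=1\otimes x_i$. Elements $\nabla_i^j(\mathbf x',\mathbf x'')\in S\otimes_KS$ are chosen such that $f_i(\mathbf x'')-f_i(\mathbf x')=\sum_{j=1}^n\nabla_i^j(\mathbf x',\mathbf x'')(x_j''-x_j')$; then $\nabla_i^j(\mathbf x,\mathbf x)=\partial f_i/\partial x_j$. $\nabla_i^j(g(\mathbf x'),\mathbf x'')$ is obtained by applying $g$ to the first tensor factor; the determinant is taken in $S\otimes_KS$ and mapped to $S\otimes_RS$. $\mathrm{Maps}(G,S)\cong S^{|G|}$, with $S$ acting on the left by pointwise multiplication, and on $S\otimes_RS$ through the first factor. $A=S*G$ is the free left $S$-module on $\{\delta_g\}_{g\in G}$ with $(s'\delta_{g'})(s\delta_g)=s'g'(s)\delta_{g'g}$, and $e=\frac1{|G|}\sum_g\delta_g$. A matrix factorization of $J$ is a pair of maps of free modules with both composites equal to multiplication by $J$; its cokernel here is $\mathrm{coker}\,\varphi$.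
   Formalization: The identity φψ = J·id fails for the stated ψ (the g-component of φψ is multiplication by g(J) = det(g)^{-1}J); this is proved instead, and the matrix factorization of J is stated for ψ with each s_g rescaled by det(g). *)

(* Defs.v *)
From HB Require Import structures.
From mathcomp Require Import all_boot all_order all_algebra all_fingroup.
From mathcomp Require Import mxrepresentation ring_quotient generic_quotient.
From mathcomp Require Import boolp ssrcomplements mpoly.

Set Implicit Arguments.
Unset Strict Implicit.
Unset Printing Implicit Defensive.

Import GRing.Theory.
Local Open Scope ring_scope.
Local Open Scope quotient_scope.

Section GeneratedSubmodule.
Variables (B : pzRingType) (M : lmodType B) (X : M -> Prop).

Definition submod_gen : {pred M} := fun y =>
  `[< exists s : seq (B * M),
        (forall c, c \in s -> X c.2) /\ y = \sum_(c <- s) c.1 *: c.2 >].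

Lemma submod_genP y :
  reflect (exists s : seq (B * M),
        (forall c, c \in s -> X c.2) /\ y = \sum_(c <- s) c.1 *: c.2)
    (y \in submod_gen).
Proof. exact: asboolP. Qed.

Lemma submod_gen_closed : submod_closed submod_gen.
Proof.
split; first by apply/submod_genP; exists [::]; split=> //; rewrite big_nil.
move=> a u v /submod_genP[s [Xs ->]] /submod_genP[t [Xt ->]].
apply/submod_genP; exists ([seq (a * c.1, c.2) | c <- s] ++ t); split.
  by move=> c; rewrite mem_cat => /orP[/mapP[d /Xs Xd ->]|/Xt].
rewrite big_cat big_map scaler_sumr; congr (_ + _).
by apply: eq_bigr => c _; rewrite scalerA.
Qed.

HB.instance Definition _ :=
  GRing.isSubmodClosed.Build B M submod_gen submod_gen_closed.

Lemma mem_submod_gen x : X x -> x \in submod_gen.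
Proof.
move=> Xx; apply/submod_genP; exists [:: (1, x)]; split.
  by move=> c; rewrite inE => /eqP ->.
by rewrite big_seq1 scale1r.
Qed.

Lemma submod_genZ a y : y \in submod_gen -> a *: y \in submod_gen.
Proof. by move=> Xy; rewrite rpredZ. Qed.

End GeneratedSubmodule.

Section QuotientModule.
Variables (B : pzRingType) (M : lmodType B) (X : M -> Prop).

(* M modulo the submodule generated by X. *)
Definition quotmod := Quotient.quot (submod_gen X).

HB.instance Definition _ := GRing.Zmodule.on quotmod.
HB.instance Definition _ := ZmodQuotient.on quotmod.

Lemma quotmod_eqP (x y : M) :
  reflect (\pi_quotmod x = \pi_quotmod y) (x - y \in submod_gen X).
Proof. by rewrite Quotient.idealrBE; exact: eqP. Qed.

Definition quotmod_scale (a : B) (x : quotmod) : quotmod :=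
  \pi_quotmod (a *: repr x).

Lemma quotmod_scale_pi a (x : M) :
  quotmod_scale a (\pi_quotmod x) = \pi_quotmod (a *: x).
Proof.
rewrite /quotmod_scale; apply/quotmod_eqP; rewrite -scalerBr rpredZ //.
by apply/quotmod_eqP; rewrite reprK.
Qed.

Lemma quotmod_piD (x y : M) :
  \pi_quotmod x + \pi_quotmod y = \pi_quotmod (x + y).
Proof. by rewrite raddfD. Qed.

Lemma quotmod_scaleA a b x :
  quotmod_scale a (quotmod_scale b x) = quotmod_scale (a * b) x.
Proof.
rewrite -[x]reprK (quotmod_scale_pi b) (quotmod_scale_pi a) scalerA.
by rewrite quotmod_scale_pi.
Qed.

Lemma quotmod_scale1 : left_id 1 quotmod_scale.
Proof. by move=> x; rewrite -[x]reprK quotmod_scale_pi scale1r. Qed.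

Lemma quotmod_scaleDr : right_distributive quotmod_scale +%R.
Proof.
move=> a x y; rewrite -[x]reprK -[y]reprK quotmod_piD !quotmod_scale_pi.
by rewrite quotmod_piD scalerDr.
Qed.

Lemma quotmod_scaleDl x : {morph quotmod_scale^~ x : a b / a + b}.
Proof.
move=> a b; rewrite -[x]reprK !quotmod_scale_pi quotmod_piD.
by rewrite scalerDl.
Qed.

HB.instance Definition _ := GRing.Zmodule_isLmodule.Build B quotmod
  quotmod_scaleA quotmod_scale1 quotmod_scaleDr quotmod_scaleDl.

Lemma quotmod_pi_linear : linear (\pi_quotmod : M -> quotmod).
Proof.
by move=> a x y; rewrite -quotmod_piD -quotmod_scale_pi.
Qed.

End QuotientModule.

Section QuotientRing.
Variables (B : comPzRingType) (X : B -> Prop).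

(* B modulo the ideal generated by X; the zero ring is allowed. *)
Definition quotring := @quotmod B B^o X.

HB.instance Definition _ := GRing.Zmodule.on quotring.
HB.instance Definition _ := ZmodQuotient.on quotring.

Definition quotring_pi (a : B) : quotring := \pi_quotring (a : B^o).

Definition quotring_mul (x y : quotring) : quotring :=
  quotring_pi (repr x * repr y).

Lemma quotring_mul_pi a b :
  quotring_mul (quotring_pi a) (quotring_pi b) = quotring_pi (a * b).
Proof.
have reprP c : repr (quotring_pi c) - c \in @submod_gen B B^o X.
  by apply/quotmod_eqP; rewrite reprK.
apply/quotmod_eqP; rewrite /=.
rewrite -[_ * _](addrNK (a * repr (quotring_pi b))) -mulrBl -addrA -mulrBr.
by rewrite rpredD //; [rewrite mulrC|]; apply: submod_genZ; apply: reprP.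
Qed.

Lemma quotring_piK x : quotring_pi (repr x) = x.
Proof. exact: reprK. Qed.

Lemma quotring_piD a b :
  quotring_pi a + quotring_pi b = quotring_pi (a + b).
Proof. exact: quotmod_piD. Qed.

Lemma quotring_mulA : associative quotring_mul.
Proof.
move=> x y z; rewrite -[x]quotring_piK -[y]quotring_piK -[z]quotring_piK.
by rewrite !quotring_mul_pi mulrA.
Qed.

Lemma quotring_mulC : commutative quotring_mul.
Proof.
move=> x y; rewrite -[x]quotring_piK -[y]quotring_piK !quotring_mul_pi.
by rewrite mulrC.
Qed.

Lemma quotring_mul1 : left_id (quotring_pi 1) quotring_mul.
Proof. by move=> x; rewrite -[x]quotring_piK quotring_mul_pi mul1r. Qed.

Lemma quotring_mulDl : left_distributive quotring_mul +%R.
Proof.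
move=> x y z; rewrite -[x]quotring_piK -[y]quotring_piK -[z]quotring_piK.
by rewrite quotring_piD !quotring_mul_pi quotring_piD mulrDl.
Qed.

HB.instance Definition _ := GRing.Zmodule_isComPzRing.Build quotring
  quotring_mulA quotring_mulC quotring_mul1 quotring_mulDl.

End QuotientRing.

Section MatrixFactorization.
Variable B : comPzRingType.
Implicit Types M N : lmodType B.

Definition finite_free M : Prop :=
  exists (r : nat) (b : 'I_r -> M),
    forall x, exists! c : {ffun 'I_r -> B}, x = \sum_i c i *: b i.

Definition matrix_factorization (w : B) M N (phi : M -> N) (psi : N -> M) :=
  (finite_free M /\ finite_free N) /\
  [/\ linear phi, linear psi,
      forall y, phi (psi y) = w *: y & forall x, psi (phi x) = w *: x].

Definition coker M N (phi : M -> N) := quotmod (fun y => exists x, phi x = y).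

HB.instance Definition _ M N (phi : M -> N) := GRing.Lmodule.on (coker phi).

Definition isomorphic_modules M N : Prop :=
  exists2 h : M -> N, linear h & bijective h.

End MatrixFactorization.

Section CohenMacaulay.
Variable B : comPzRingType.
Implicit Types (I P : B -> Prop) (M : lmodType B).

Definition is_ideal I := I 0 /\ forall a u v, I u -> I v -> I (a * u + v).

Definition prime_ideal P :=
  [/\ is_ideal P, ~ P 1 & forall u v, P (u * v) -> P u \/ P v].

Definition maximal_ideal P :=
  [/\ is_ideal P, ~ P 1 &
      forall I, is_ideal I -> ~ I 1 -> (forall u, P u -> I u) ->
        forall u, I u -> P u].

Definition prime_chain_in P (d : nat) :=
  exists p : nat -> B -> Prop,
    [/\ forall i, (i <= d)%N -> prime_ideal (p i),
        forall i, (i < d)%N ->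
          (forall u, p i u -> p i.+1 u) /\ exists2 u, p i.+1 u & ~ p i u
      & forall u, p d u -> P u].

(* Krull dimension of the local ring B_P: its primes are those inside P. *)
Definition dim_at P (d : nat) := prime_chain_in P d /\ ~ prime_chain_in P d.+1.

(* y/1 lies in N_P, for a submodule N of M. *)
Definition mem_loc P M (N : {pred M}) (y : M) :=
  exists2 t : B, ~ P t & t *: y \in N.

Definition ideal_smul M (xs : seq B) : {pred M} :=
  submod_gen (fun y : M => exists2 x, x \in xs & exists z, y = x *: z).
Arguments ideal_smul M xs : clear implicits.

(* The images of xs in the local ring B_P form an M_P-regular sequence in its
   maximal ideal.  Up to units of B_P every sequence in P B_P is of this form,
   and fractions y/s have been replaced by their numerators. *)
Definition regular_at P M (xs : seq B) :=
  [/\ forall x, x \in xs -> P x,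
      forall i, (i < size xs)%N -> forall y : M,
        mem_loc P (ideal_smul M (take i xs)) (xs`_i *: y) ->
        mem_loc P (ideal_smul M (take i xs)) y
    & exists y : M, ~ mem_loc P (ideal_smul M xs) y].

(* depth of M_P over B_P. *)
Definition depth_at P M (d : nat) :=
  (exists2 xs, regular_at P M xs & size xs = d) /\
  (forall xs, regular_at P M xs -> (size xs <= d)%N).

Definition finitely_generated M :=
  exists s : seq M, forall x, x \in submod_gen (fun y : M => y \in s).

(* For B noetherian: depth M_P = dim B_P at every maximal ideal P. *)
Definition maximal_Cohen_Macaulay M :=
  finitely_generated M /\
  forall P, maximal_ideal P -> exists2 d, dim_at P d & depth_at P M d.

End CohenMacaulay.

Section ReflectionGroup.
Variables (K : fieldType) (n : nat) (gT : finGroupType).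
Variable rG : mx_representation K [set: gT] n.

Local Notation S := {mpoly K[n]}.

(* V is the space of column vectors, with standard basis x_1, ..., x_n, so that
   g x_j is column j of the matrix of g; with this convention g |-> Sact g is a
   left action. *)
Definition Sact_var (g : gT) (j : 'I_n) : S := \sum_k rG g k j *: 'X_k.

Definition Sact (g : gT) : S -> S := comp_mpoly [tuple Sact_var g j | j < n].

HB.instance Definition _ g :=
  GRing.RMorphism.copy (Sact g) (comp_mpoly [tuple Sact_var g j | j < n]).

Lemma SactX g j : Sact g 'X_j = Sact_var g j.
Proof. by rewrite /Sact comp_mpolyXU -tnth_nth tnth_mktuple. Qed.

Lemma SactZ g a p : Sact g (a *: p) = a *: Sact g p.
Proof. by rewrite /Sact comp_mpolyZ. Qed.

Lemma SactC g a : Sact g a%:MP = a%:MP.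
Proof. by rewrite /Sact comp_mpolyC. Qed.

Lemma Sact_mul g p q : Sact g (p * q) = Sact g p * Sact g q.
Proof. exact: rmorphM. Qed.

Lemma Sact_add g p q : Sact g (p + q) = Sact g p + Sact g q.
Proof. exact: raddfD. Qed.

Lemma Sact_sum g (I : finType) (F : I -> S) :
  Sact g (\sum_i F i) = \sum_i Sact g (F i).
Proof. exact: raddf_sum. Qed.

Lemma Sact_nat g (k : nat) : Sact g k%:R = k%:R.
Proof. exact: (rmorph_nat (Sact g)). Qed.

Lemma Sact_ext (F1 F2 : {rmorphism S -> S}) :
  (forall a, F1 a%:MP = F2 a%:MP) -> (forall j, F1 'X_j = F2 'X_j) ->
  F1 =1 F2.
Proof.
move=> eqC eqX p; rewrite (mpolyE p) !rmorph_sum; apply: eq_bigr => m _ /=.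
rewrite -mul_mpolyC !rmorphM eqC mpolyXE_id !rmorph_prod; congr (_ * _).
by apply: eq_bigr => j _; rewrite !rmorphXn eqX.
Qed.

Lemma Sact1 p : Sact 1%g p = p.
Proof.
apply: (@Sact_ext (Sact 1%g) idfun) p => [a|j] /=; first exact: SactC.
rewrite SactX /Sact_var (bigD1 j) //= repr_mx1 mxE eqxx scale1r big1 ?addr0 //.
by move=> k /negPf kj; rewrite mxE kj scale0r.
Qed.

Lemma SactM g h p : Sact (g * h)%g p = Sact g (Sact h p).
Proof.
apply: (@Sact_ext (Sact (g * h)%g) (Sact g \o Sact h)) p => [a|j] /=.
  by rewrite !SactC.
rewrite !SactX /Sact_var raddf_sum; under [RHS]eq_bigr => k _.
  rewrite /= SactZ SactX /Sact_var scaler_sumr; over.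
rewrite exchange_big; apply: eq_bigr => k _ /=.
rewrite repr_mxM ?inE // mxE scaler_suml; apply: eq_bigr => l _.
by rewrite scalerA mulrC.
Qed.

Definition pseudo_reflection (g : gT) : Prop :=
  (0 < n)%N /\
  exists (zeta : K) (P : 'M[K]_n),
    [/\ zeta != 1, exists2 k, (0 < k)%N & zeta ^+ k = 1, P \in unitmx
      & P *m rG g *m invmx P =
          diag_mx (\row_i (if (i : nat) == 0%N then zeta else 1))].

Definition generated_by_pseudo_reflections : Prop :=
  exists2 T : {set gT}, (forall g, g \in T -> pseudo_reflection g)
    & <<T>>%g = [set: gT].

Definition Sinvariant (p : S) : Prop := forall g, Sact g p = p.

Definition basic_invariants (f : n.-tuple S) : Prop :=
  [/\ forall i, exists d, tnth f i \is d.-homog,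
      forall i, Sinvariant (tnth f i),
      injective (fun q : {mpoly K[n]} => q \mPo f)
    & forall p, Sinvariant p -> exists q : {mpoly K[n]}, p = q \mPo f].

Definition jacobian (f : n.-tuple S) : S :=
  \det (\matrix_(i, j) (tnth f i)^`M(j)).

(* S (x)_K S = K[x', x''], as polynomials in x'' with coefficients in K[x']. *)
Local Notation SS := {mpoly S[n]}.

Definition tensK (a b : S) : SS := a *: map_mpoly (@mpolyC n K) b.

Definition divided_differences (f : n.-tuple S) (nabla : 'I_n -> 'I_n -> SS) :=
  forall i, tensK 1 (tnth f i) - tensK (tnth f i) 1 =
    \sum_j nabla i j * (tensK 1 'X_j - tensK 'X_j 1).

Definition Sact_left (g : gT) : SS -> SS := map_mpoly (Sact g).

Lemma Sact_left_tensK g a b : Sact_left g (tensK a b) = tensK (Sact g a) b.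
Proof.
(* Explicit transitivity steps: rewriting here triggers expensive unification. *)
pose b'' : SS := map_mpoly (@mpolyC n K) b.
have act_b'' : map_mpoly (Sact g) b'' = b''.
  apply/mpolyP => m; have b''m := mcoeff_map_mpoly (@mpolyC n K) m b.
  apply: (etrans (mcoeff_map_mpoly (Sact g) m b'')).
  exact: etrans (congr1 (Sact g) b''m) (etrans (SactC g _) (esym b''m)).
apply: (etrans (map_mpolyZ (Sact g) a b'')).
exact: (congr1 (fun q => Sact g a *: q) act_b'').
Qed.

(* S (x)_R S for R = S^G: the quotient of S (x)_K S by the ideal generated by
   the elements 1 (x) r - r (x) 1 with r in R; see tensR_universal below. *)
Definition tensR_rel (y : SS) : Prop :=
  exists (p : SS) (r : S), Sinvariant r /\ y = p * (tensK 1 r - tensK r 1).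

Definition SRS := quotmod tensR_rel.

HB.instance Definition _ := GRing.Lmodule.on SRS.
HB.instance Definition _ := ZmodQuotient.on SRS.

Definition tensR (a b : S) : SRS := \pi_SRS (tensK a b).

Definition Maps := {ffun gT -> S^o}.

HB.instance Definition _ := GRing.Lmodule.on Maps.

Definition phiK (g : gT) : SS -> S := meval (Sact_var g).

HB.instance Definition _ g := GRing.RMorphism.copy (phiK g) (meval (Sact_var g)).

Lemma phiK_tens g a b : phiK g (tensK a b) = a * Sact g b.
Proof.
rewrite /phiK /tensK mevalZ; congr (_ * _).
apply: (@Sact_ext (phiK g \o map_mpoly (@mpolyC n K)) (Sact g)) b => [a'|j] /=.
  by rewrite map_mpolyC SactC /phiK mevalC.
by rewrite map_mpolyX SactX /phiK mevalXU.
Qed.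

Definition phi (x : SRS) : Maps := [ffun g => phiK g (repr x)].

Lemma phiK_rel g y : tensR_rel y -> phiK g y = 0.
Proof.
case=> p [r [invr ->]]; apply: (etrans (rmorphM (phiK g) _ _)).
have d0 : phiK g (tensK 1 r - tensK r 1) = 0.
  apply: (etrans (raddfB (phiK g) _ _)); apply/eqP; rewrite subr_eq0; apply/eqP.
  apply: (etrans (phiK_tens g 1 r)); apply: (etrans _ (esym (phiK_tens g r 1))).
  by rewrite invr (Sact_nat g 1) mul1r mulr1.
by apply: (etrans (congr1 _ d0)); apply: mulr0.
Qed.

Lemma phi_pi (p : SS) g : phi (\pi_SRS p) g = phiK g p.
Proof.
rewrite ffunE; apply/eqP; rewrite -subr_eq0 -(raddfB (phiK g)); apply/eqP.
have : repr (\pi_SRS p) - p \in submod_gen tensR_rel.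
  by apply/quotmod_eqP; rewrite reprK.
case/submod_genP => s [Xs ->].
rewrite (raddf_sum (phiK g)) big_seq big1 //= => c /Xs/(phiK_rel g) c0.
by apply: (etrans (mevalZ _ _ _)); apply: (etrans (congr1 _ c0)); apply: mulr0.
Qed.

Lemma MapsE (a : S) (s t : Maps) g : (a *: s + t) g = a * (s g : S) + t g.
Proof. by rewrite ffunE [X in X + _]ffunE. Qed.

Lemma phi_linear : linear phi.
Proof.
move=> a x y; rewrite -[x]reprK -[y]reprK.
have <- : \pi_SRS (a *: repr x + repr y) =
    a *: (\pi_SRS (repr x) : SRS) + \pi_SRS (repr y) by apply: quotmod_pi_linear.
apply/ffunP => g; apply: (etrans (phi_pi _ g)).
apply: (etrans (raddfD (phiK g) _ _)); apply: (etrans _ (esym (MapsE _ _ _ g))).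
rewrite !phi_pi; congr (_ + _); exact: mevalZ.
Qed.

Lemma phi_tensR a b g : phi (tensR a b) g = a * Sact g b.
Proof. by rewrite phi_pi phiK_tens. Qed.

Definition psi (nabla : 'I_n -> 'I_n -> SS) (s : Maps) : SRS :=
  \sum_g (s g : S) *:
     \pi_SRS (\det (\matrix_(i, j) Sact_left g (nabla i j))).

Definition Maps_det_twist (s : Maps) : Maps :=
  [ffun g => \det (rG g) *: (s g : S)].

(* psi sends the g-th basis element of Maps to det(nabla(g x', x'')), whose image
   under phi is supported at g with value g(J) = det(g)^-1 J: rescaling by det(g)
   is what makes the composite with phi equal to multiplication by J. *)
Definition psi_det (nabla : 'I_n -> 'I_n -> SS) (s : Maps) : SRS :=
  psi nabla (Maps_det_twist s).

(* The skew group ring S * G; a : skew rG stands for \sum_g a g \delta_g. *)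
Definition skew (_ : mx_representation K [set: gT] n) := {ffun gT -> S^o}.

HB.instance Definition _ := GRing.Lmodule.on (skew rG).

Local Notation A := (skew rG).

Definition delta (g : gT) : A := [ffun h => (h == g)%:R].

Definition skew_mul (a b : A) : A :=
  [ffun h => \sum_g (a g : S) * Sact g (b (g^-1 * h)%g)].

Lemma skew_mulE (a b : A) h :
  skew_mul a b h = \sum_g (a g : S) * Sact g (b (g^-1 * h)%g).
Proof. exact: ffunE. Qed.

Lemma skewDE (a b : A) h : (a + b) h = (a h : S) + b h.
Proof. exact: ffunE. Qed.

Lemma skew_mulA : associative skew_mul.
Proof.
move=> a b c; apply/ffunP => h; rewrite !skew_mulE.
transitivity (\sum_g \sum_k (a g : S) * Sact g (b (g^-1 * k)%g) *
    Sact k (c (k^-1 * h)%g)).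
  apply: eq_bigr => g _; rewrite skew_mulE Sact_sum mulr_sumr.
  rewrite (reindex_inj (h := fun k => (g^-1 * k)%g)); last exact: mulgI.
  apply: eq_bigr => k _.
  by rewrite Sact_mul -SactM mulrA mulKVg invMg invgK -mulgA mulKVg.
rewrite exchange_big; apply: eq_bigr => k _.
by rewrite skew_mulE mulr_suml.
Qed.

Lemma skew_mul1 : left_id (delta 1) skew_mul.
Proof.
move=> a; apply/ffunP => h; rewrite skew_mulE (bigD1 1%g) //= big1 => [|g].
  by rewrite ffunE eqxx mul1r addr0 Sact1 invg1 mul1g.
by move=> /negPf g1; rewrite ffunE g1 mul0r.
Qed.

Lemma skew_mulr1 : right_id (delta 1) skew_mul.
Proof.
move=> a; apply/ffunP => h; rewrite skew_mulE (bigD1 h) //= big1 => [|g].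
  by rewrite ffunE mulVg eqxx (Sact_nat h 1) mulr1 addr0.
move=> gh; rewrite ffunE -eq_mulVg1 (negPf gh).
by rewrite (Sact_nat g 0) mulr0.
Qed.

Lemma skew_mulDl : left_distributive skew_mul +%R.
Proof.
move=> a b c; apply/ffunP => h; rewrite skewDE !skew_mulE -big_split.
by apply: eq_bigr => g _; rewrite skewDE mulrDl.
Qed.

Lemma skew_mulDr : right_distributive skew_mul +%R.
Proof.
move=> a b c; apply/ffunP => h; rewrite skewDE !skew_mulE -big_split.
by apply: eq_bigr => g _; rewrite skewDE Sact_add mulrDr.
Qed.

HB.instance Definition _ := GRing.Zmodule_isPzRing.Build A
  skew_mulA skew_mul1 skew_mulr1 skew_mulDl skew_mulDr.

Lemma skewZ_deltaE (r : S) k h : (r *: delta k : A) h = r * (h == k)%:R.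
Proof. by rewrite ffunE; congr (_ * _); rewrite ffunE. Qed.

Lemma skew_mul_delta (s' s : S) g' g :
  (s' *: delta g' : A) * (s *: delta g) = (s' * Sact g' s) *: delta (g' * g)%g.
Proof.
apply/ffunP => h; apply: (etrans (skew_mulE _ _ _)).
apply: (etrans _ (esym (skewZ_deltaE _ _ _))).
transitivity (\sum_k s' * (k == g')%:R * Sact k (s * (k^-1 * h == g)%g%:R)).
  apply: eq_bigr => k _.
  exact: (congr2 (fun u v => u * Sact k v)
            (skewZ_deltaE s' g' k) (skewZ_deltaE s g (k^-1 * h)%g)).
rewrite (bigD1 g') //= big1 => [|k /negPf kg']; last by rewrite kg' mulr0 mul0r.
rewrite eqxx mulr1 addr0 Sact_mul Sact_nat mulrA; congr (_ * _%:R).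
by rewrite -(inj_eq (mulgI g')) mulKVg.
Qed.

Definition skew_idem : A := (#|gT|%:R^-1 : K)%:MP *: \sum_g delta g.

(* A / AeA as a left S-module. *)
Definition skew_bar :=
  quotmod (fun y : A => exists a b : A, y = a * skew_idem * b).

HB.instance Definition _ := GRing.Lmodule.on skew_bar.

Lemma tensKDl (a b c : S) : tensK (a + b) c = tensK a c + tensK b c.
Proof. exact: scalerDl. Qed.

Lemma tensKDr (a b c : S) : tensK a (b + c) = tensK a b + tensK a c.
Proof.
apply: (etrans (congr1 (fun q : SS => a *: q) (raddfD _ _ _))).
exact: scalerDr.
Qed.

Lemma tensK_mul (a b c d : S) : tensK a b * tensK c d = tensK (a * c) (b * d).
Proof.
apply: (etrans (esym (scalerAl _ _ _))).
apply: (etrans (congr1 (fun q : SS => a *: q) (esym (scalerAr _ _ _)))).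
apply: (etrans (scalerA _ _ _)).
exact: (congr1 (fun q : SS => (a * c) *: q) (esym (rmorphM _ _ _))).
Qed.

Lemma tensK_sum (p : SS) : p = \sum_(m <- msupp p) tensK p@_m 'X_[m].
Proof.
rewrite {1}[p]mpolyE; apply: eq_bigr => m _.
exact: (congr1 (fun q : SS => p@_m *: q) (esym (map_mpolyX _ m))).
Qed.

(* Universal property of S (x)_R S among abelian groups. *)
Lemma tensR_universal (W : zmodType) (b : S -> S -> W) :
  (forall y, {morph b^~ y : x x' / x + x'}) ->
  (forall x, {morph b x : y y' / y + y'}) ->
  (forall x r y, Sinvariant r -> b (x * r) y = b x (r * y)) ->
  exists! h : SRS -> W,
    {morph h : x y / x + y} /\ forall x y, h (tensR x y) = b x y.
Proof.
move=> bDl bDr bR.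
have b0l y : b 0 y = 0 by apply: (addrI (b 0 y)); rewrite -bDl !addr0.
have b0r x : b x 0 = 0 by apply: (addrI (b x 0)); rewrite -bDr !addr0.
have bsum x (I : Type) (s : seq I) (F : I -> S) :
    b x (\sum_(i <- s) F i) = \sum_(i <- s) b x (F i).
  by elim: s => [|i s IHs]; rewrite ?big_nil ?b0r // !big_cons bDr IHs.
have bC x c y : b (x * c%:MP) y = b x (c *: y).
  by rewrite bR ?mul_mpolyC // => g; exact: SactC.
pose lift (p : SS) := \sum_(m <- msupp p) b p@_m 'X_[m].
have liftE (p : SS) k : (msize p <= k)%N ->
    lift p = \sum_(m : 'X_{1..n < k}) b p@_m 'X_[m].
  move=> le_pk; rewrite /lift; pose I : subFinType _ := 'X_{1..n < k}.
  rewrite (big_mksub I) //=; first last.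
  - by move=> m /msize_mdeg_lt /leq_trans; apply.
  - by rewrite msupp_uniq.
  by rewrite big_rmcond //= => m /memN_msupp_eq0 ->; rewrite b0l.
have liftD : {morph lift : p q / p + q}.
  move=> p q; pose k := maxn (msize (p + q)) (maxn (msize p) (msize q)).
  rewrite !(@liftE _ k) ?leq_max ?leqnn ?orbT // -big_split.
  by apply: eq_bigr => m _; rewrite mcoeffD bDl.
have lift0 : lift 0 = 0 by rewrite /lift msupp0 big_nil.
have lift_sum (I : Type) (s : seq I) (F : I -> SS) :
    lift (\sum_(i <- s) F i) = \sum_(i <- s) lift (F i).
  by elim: s => [|i s IHs]; rewrite ?big_nil ?lift0 // !big_cons liftD IHs.
have liftN p : lift (- p) = - lift p.
  by apply: (addrI (lift p)); rewrite -liftD !subrr lift0.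
have lift_tens x y : lift (tensK x y) = b x y.
  pose k := maxn (msize (tensK x y)) (msize y).
  rewrite (@liftE _ k) ?leq_maxl // {2}[y](mpolywE (k := k)) ?leq_maxr // bsum.
  apply: eq_bigr => m _; rewrite -bC; congr (b _ _).
  apply: (etrans (mcoeffZ _ _ _)).
  by have -> := mcoeff_map_mpoly (@mpolyC n K) m y.
clearbody lift.
have lift_rel y : tensR_rel y -> lift y = 0.
  case=> p [r [invr ->]]; rewrite {1}[p]tensK_sum mulr_suml lift_sum big1 // => m _.
  set u := p@_m; set v := 'X_[m].
  have Er : tensK u v * tensK 1 r = tensK u (v * r).
    exact: etrans (tensK_mul u v 1 r) (congr1 (tensK^~ _) (mulr1 u)).
  have El : tensK u v * tensK r 1 = tensK (u * r) v.
    exact: etrans (tensK_mul u v r 1) (congr1 (tensK _) (mulr1 v)).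
  apply: (etrans (congr1 lift (mulrBr _ _ _))); apply: (etrans (liftD _ _)).
  apply: (etrans (congr2 (fun q t => lift q + lift (- t)) Er El)).
  apply: (etrans (congr1 (+%R _) (liftN _))).
  apply: (etrans (congr2 (fun q t : W => q - t) (lift_tens _ _) (lift_tens _ _))).
  by rewrite (bR u r v invr) [r * v]mulrC subrr.
have lift_gen y : y \in submod_gen tensR_rel -> lift y = 0.
  case/submod_genP => s [Xs ->]; rewrite lift_sum big_seq big1 // => c /Xs.
  case=> p [r [invr ->]]; apply: lift_rel; exists (c.1 *: p), r; split=> //.
  exact: scalerAl.
pose h (x : SRS) := lift (repr x).
have h_pi p : h (\pi_SRS p) = lift p.
  apply/eqP; rewrite -subr_eq0 -liftN -liftD lift_gen //.
  by apply/quotmod_eqP; rewrite reprK.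
have pi_sum (I : Type) (s : seq I) (F : I -> SS) :
    \pi_SRS (\sum_(i <- s) F i) = \sum_(i <- s) (\pi_SRS (F i) : SRS).
  elim: s => [|i s IHs]; rewrite ?big_nil; first exact: raddf0.
  by rewrite !big_cons -IHs; exact: raddfD.
exists h; split.
  split=> [x y|x y]; last by rewrite h_pi lift_tens.
  have -> : x + y = \pi_SRS (repr x + repr y).
    by rewrite -[in LHS](reprK x) -[in LHS](reprK y); apply: quotmod_piD.
  by rewrite h_pi liftD.
move=> h' [h'D h't]; apply/funext => x; rewrite -[x]reprK h_pi.
have h'0 : h' 0 = 0 by apply: (addrI (h' 0)); rewrite -h'D !addr0.
rewrite (tensK_sum (repr x)) lift_sum pi_sum.
elim: (msupp _) => [|m s IHs]; first by rewrite !big_nil.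
rewrite !big_cons h'D IHs; congr (_ + _).
by rewrite lift_tens; apply/esym/h't.
Qed.

End ReflectionGroup.

(* Main.v *)
(* For h <> g the nonzero vector (h x_j - g x_j)_j is killed by the matrix nabla(g x, h x),
   while nabla(x, x) is the Jacobian matrix; hence phi psi is multiplication by g(J) at g.
   By Chevalley's theorem S is free over the invariants, so S (x)_R S is free over S;
   pairing with det nabla shows that phi is injective, so that phi psi_det = J also
   gives psi_det phi = J.  The image of phi is AeA.

   J divides a product of linear forms, so every zero v of J lies on a hyperplane where
   J vanishes: flags of affine subspaces of it through v give chains of n - 1 primes
   above J.  The linear forms cutting out a line through v on which J is nonzero form a
   regular sequence of length n - 1 on the cokernel, which does not vanish at v because
   some g <> 1 fixes v.  Neither length can exceed n - 1, since J and n further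
   polynomials satisfy an algebraic relation.  All maximal ideals come from points
   because the field of complex numbers is uncountable and algebraically closed. *)

Require Import Defs.
From HB Require Import structures.
From mathcomp Require Import all_boot all_order all_algebra all_fingroup.
From mathcomp Require Import mxrepresentation ring_quotient generic_quotient.
From mathcomp Require Import boolp reals complex mpoly.

Set Implicit Arguments.
Unset Strict Implicit.
Unset Printing Implicit Defensive.

Import GRing.Theory.
Local Open Scope ring_scope.
Local Open Scope quotient_scope.

(** * Polynomial substitutions *)

(** Both upper bounds come from one statement about an increasing family of submodules T_0, T_1,
    ...: x_i cancels modulo T_i and multiplies everything into T_(i+1). Strictly increasing primes
    give such a family, with x_i in the next prime but not in the present one; so does a regular
    sequence, with T_i the localized submodule generated by its first i terms. A polynomial relation
    among the x_i modulo J then collapses the family: its lowest-order part has a coefficient in K,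
    which is a unit, and everything else is absorbed one level up.

    For the lower bound on depth no homological theory is used. As psi phi = J on free modules, a
    sequence that is regular on S and stays regular together with J can be chased through phi and
    psi to the cokernel.

    Ideals of linear subspaces are handled as kernels of explicit substitutions into polynomial
    rings, so primality and regularity reduce to the absence of zero divisors there. *)

Section Polynomials.
Variables (K : comNzRingType) (n : nat).
Implicit Types (p : {mpoly K[n]}).

Lemma mpoly_alg_ind (P : {mpoly K[n]} -> Prop) :
  (forall a, P a%:MP) -> (forall j, P 'X_j) ->
  (forall p q, P p -> P q -> P (p + q)) ->
  (forall p q, P p -> P q -> P (p * q)) -> forall p, P p.
Proof.
move=> PC PX PD PM; have P0 : P 0 by rewrite -mpolyC0.
have P1 : P 1 by rewrite -mpolyC1.
elim/mpolyind => // c m p _ _ Pp; apply: (PD) => //.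
rewrite -mul_mpolyC mpolyXE_id; apply: (PM) => //.
apply: (big_ind P) => // i _.
by elim: (m i) => [|k IHk]; rewrite ?expr0 // exprS; apply: PM.
Qed.

(** The polynomials on which two morphisms agree modulo an ideal form a subalgebra, so the variables
    suffice. Used with the zero ideal, the multiples of a linear form, the ideal of the basic
    invariants, and maximal ideals. *)
Lemma mpoly_congr (B : comNzRingType) (h1 h2 : {rmorphism {mpoly K[n]} -> B})
    (I : B -> Prop) : is_ideal I ->
  (forall a, h1 a%:MP = h2 a%:MP) -> (forall j, I (h1 'X_j - h2 'X_j)) ->
  forall p, I (h1 p - h2 p).
Proof.
case=> I0 IL hC hX; have ID u v : I u -> I v -> I (u + v).
  by move=> Iu Iv; rewrite -[u]mul1r; apply: IL.
have IM a u : I u -> I (a * u) by move=> Iu; rewrite -[_ * _]addr0; apply: IL.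
apply: mpoly_alg_ind => // [a|p q Ip Iq|p q Ip Iq]; first by rewrite hC subrr.
  by rewrite !rmorphD opprD addrACA; apply: ID.
have -> : h1 (p * q) - h2 (p * q) =
    h1 p * (h1 q - h2 q) + h2 q * (h1 p - h2 p).
  by rewrite !rmorphM mulrBr mulrBr addrA [h2 q * _]mulrC subrK [h2 q * _]mulrC.
by apply: ID; apply: IM.
Qed.

Lemma mpoly_rmorph_ext (B : comNzRingType)
    (h1 h2 : {rmorphism {mpoly K[n]} -> B}) :
  (forall a, h1 a%:MP = h2 a%:MP) -> (forall j, h1 'X_j = h2 'X_j) -> h1 =1 h2.
Proof.
move=> hC hX p; apply/eqP; rewrite -subr_eq0; apply/eqP.
apply: (@mpoly_congr _ h1 h2 (fun u => u = 0)) => // [|j]; last first.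
  by rewrite hX subrr.
by split=> // a u v -> ->; rewrite mulr0 addr0.
Qed.

Definition msubst k (y : 'I_n -> {mpoly K[k]}) : {mpoly K[n]} -> {mpoly K[k]} :=
  comp_mpoly (mktuple y).

HB.instance Definition _ k (y : 'I_n -> {mpoly K[k]}) :=
  GRing.RMorphism.copy (msubst y) (comp_mpoly (mktuple y)).

Lemma msubstX k (y : 'I_n -> {mpoly K[k]}) j : msubst y 'X_j = y j.
Proof. by rewrite /msubst comp_mpolyXU -tnth_nth tnth_mktuple. Qed.

Lemma msubstC k (y : 'I_n -> {mpoly K[k]}) a : msubst y a%:MP = a%:MP.
Proof. exact: comp_mpolyC. Qed.

Lemma msubstZ k (y : 'I_n -> {mpoly K[k]}) a p :
  msubst y (a *: p) = a *: msubst y p.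
Proof. exact: comp_mpolyZ. Qed.

Lemma msubst_meval k (y : 'I_n -> {mpoly K[k]}) v p :
  (msubst y p).@[v] = p.@[fun j => (y j).@[v]].
Proof.
by rewrite /msubst comp_mpoly_meval; apply: meval_eq => j; rewrite tnth_mktuple.
Qed.

Lemma msubst_comp k (y : 'I_n -> {mpoly K[n]}) (z : 'I_n -> {mpoly K[k]}) w p :
  (forall j, msubst z (y j) = w j) -> msubst z (msubst y p) = msubst w p.
Proof.
move=> eqw; apply: (@mpoly_rmorph_ext _ (msubst z \o msubst y) (msubst w)) => [a|j] /=.
  by rewrite !msubstC.
by rewrite !msubstX.
Qed.

Lemma mderivXU (i j : 'I_n) : ('X_i : {mpoly K[n]})^`M(j) = (i == j)%:R.
Proof.
rewrite mderivX mnm1E; case: eqP => [->|_]; last by rewrite scale0r.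
by rewrite -[X in (X - _)%MM]add0m addmK mpolyX0 scale1r.
Qed.

Lemma mderiv_comp k (t : n.-tuple {mpoly K[k]}) p (l : 'I_k) :
  (p \mPo t)^`M(l) = \sum_j (p^`M(j) \mPo t) * (tnth t j)^`M(l).
Proof.
elim/mpoly_alg_ind: p => [a|i|p q IHp IHq|p q IHp IHq].
- rewrite comp_mpolyC mderivC big1 // => j _.
  by rewrite mderivC comp_mpoly0 mul0r.
- rewrite comp_mpolyXU -tnth_nth (bigD1 i) //= big1 => [|j ji].
    by rewrite mderivXU eqxx comp_mpoly1 mul1r addr0.
  by rewrite mderivXU eq_sym (negPf ji) comp_mpoly0 mul0r.
- rewrite comp_mpolyD mderivD IHp IHq -big_split; apply: eq_bigr => j _ /=.
  by rewrite mderivD comp_mpolyD mulrDl.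
- rewrite (rmorphM (comp_mpoly t)) mderivM IHp IHq mulr_suml mulr_sumr -big_split.
  apply: eq_bigr => j _ /=; rewrite mderivM comp_mpolyD !(rmorphM (comp_mpoly t)) mulrDl.
  by rewrite -!mulrA [_^`M(l) * _]mulrC.
Qed.

Lemma mderiv_map (B : comNzRingType) (h : {rmorphism K -> B}) p (l : 'I_n) :
  (map_mpoly h p)^`M(l) = map_mpoly h p^`M(l).
Proof.
apply/mpolyP => m; rewrite mcoeff_mderiv !mcoeff_map_mpoly mcoeff_mderiv.
by rewrite raddfMn.
Qed.

End Polynomials.

(** * Divided differences *)

Section Psi.
Variables (K : fieldType) (n : nat) (gT : finGroupType).
Variable rG : mx_representation K [set: gT] n.
Local Notation S := {mpoly K[n]}.
Local Notation SS := {mpoly S[n]}.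
Variable f : n.-tuple S.
Variable nabla : 'I_n -> 'I_n -> SS.

HB.instance Definition _ g := GRing.RMorphism.copy (Sact_left rG g)
  (map_mpoly (Sact rG g)).

Lemma Sact_leftC g (a : S) : Sact_left rG g a%:MP = (Sact rG g a)%:MP.
Proof. exact: map_mpolyC. Qed.

Lemma Sact_leftX g j : Sact_left rG g 'X_j = 'X_j.
Proof. exact: map_mpolyX. Qed.

Lemma phiKC g (a : S) : phiK rG g a%:MP = a.
Proof. exact: mevalC. Qed.

Lemma phiKX g j : phiK rG g 'X_j = Sact_var rG g j.
Proof. exact: mevalXU. Qed.

Lemma phiK_Sact_left g (y : SS) :
  phiK rG g (Sact_left rG g y) = Sact rG g (phiK rG 1%g y).
Proof.
apply: (mpoly_rmorph_ext (h1 := phiK rG g \o Sact_left rG g)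
  (h2 := Sact rG g \o phiK rG 1%g)) => [a|j] /=.
  by rewrite Sact_leftC !phiKC.
by rewrite Sact_leftX !phiKX -!SactX Sact1.
Qed.

Lemma Sact_var_inj g h : mx_faithful rG ->
  (forall j, Sact_var rG g j = Sact_var rG h j) -> g = h.
Proof.
move=> faith eq_gh; apply: (mx_faithful_inj faith); rewrite ?inE //.
apply/matrixP => k j; have /(congr1 (mcoeff U_(k))) := eq_gh j.
rewrite /Sact_var !raddf_sum /= (bigD1 k) //= [in X in _ = X -> _](bigD1 k) //=.
rewrite !mcoeffZ !mcoeffX eqxx !mulr1 !big1 ?addr0 // => i ik;
  by rewrite mcoeffZ mcoeffX eq_mnm1 (negPf ik) mulr0.
Qed.

Lemma tensK1l (b : S) : tensK 1 b = map_mpoly (@mpolyC n K) b.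
Proof. exact: scale1r. Qed.

Lemma tensK1r (a : S) : tensK a 1 = a%:MP.
Proof.
apply: etrans (congr1 (fun q : SS => a *: q) (rmorph1 (map_mpoly (@mpolyC n K)))) _.
by rewrite -mul_mpolyC mulr1.
Qed.

Lemma Sact_left_lift g (b : S) :
  Sact_left rG g (map_mpoly (@mpolyC n K) b) = map_mpoly (@mpolyC n K) b.
Proof. by have := Sact_left_tensK rG g 1 b; rewrite (Sact_nat rG g 1) tensK1l. Qed.

Lemma phiK_lift g (b : S) : phiK rG g (map_mpoly (@mpolyC n K) b) = Sact rG g b.
Proof. by have := phiK_tens rG g 1 b; rewrite tensK1l mul1r. Qed.

Section DividedDifferences.
Hypothesis nablaP : divided_differences f nabla.

Lemma divided_differencesE i :
  map_mpoly (@mpolyC n K) (tnth f i) - (tnth f i)%:MP =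
    \sum_j nabla i j * ('X_j - ('X_j)%:MP) :> SS.
Proof.
have := nablaP i; rewrite tensK1l tensK1r => ->; apply: eq_bigr => j _.
by rewrite tensK1l tensK1r map_mpolyX.
Qed.

(** Differentiate the defining identity in x''_j and restrict to the diagonal: a term survives only
    if its factor x''_l - x'_l was the one differentiated. *)
Lemma phiK1_nabla i j : phiK rG 1%g (nabla i j) = (tnth f i)^`M(j).
Proof.
have mX l : phiK rG 1%g ('X_l - ('X_l)%:MP) = 0.
  by rewrite rmorphB /= phiKX phiKC -SactX Sact1 subrr.
have /(congr1 (fun q => phiK rG 1%g q^`M(j))) := divided_differencesE i.
rewrite mderivB mderivC subr0 mderiv_map phiK_lift Sact1 => ->.
rewrite (raddf_sum (mderiv j)) (raddf_sum (phiK rG 1%g)) /= (bigD1 j) //=.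
rewrite big1 ?addr0 => [|l lj]; rewrite mderivM rmorphD !rmorphM /= mX mulr0 add0r.
  by rewrite mderivB mderivC subr0 mderivXU eqxx rmorph1 mulr1.
by rewrite mderivB mderivC subr0 mderivXU (negPf lj) rmorph0 mulr0.
Qed.

Hypothesis faithful_rG : mx_faithful rG.
Hypothesis invf : forall i, Sinvariant rG (tnth f i).

Lemma phiK_det_nabla g h :
  phiK rG h (\det (\matrix_(i, j) Sact_left rG g (nabla i j))) =
    (h == g)%:R * Sact rG g (jacobian f).
Proof.
rewrite -det_map_mx; have [->|neq_hg] := eqVneq h g.
  rewrite mul1r /jacobian -det_map_mx; congr (\det _); apply/matrixP => i j.
  by rewrite !mxE -phiK1_nabla; exact: phiK_Sact_left.
rewrite mul0r; set M := map_mx _ _; pose v : 'cV[S]_n :=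
  \col_j (Sact_var rG h j - Sact_var rG g j).
(* Row i of [M *m v] is the image of f_i(x'') - f_i(x') under [theta], that is h f_i - g f_i, which
   is zero by invariance. *)
have Mv0 : M *m v = 0.
  apply/matrixP => i o; rewrite !mxE.
  pose theta : {rmorphism SS -> S} := phiK rG h \o Sact_left rG g.
  have thetaL b : theta (map_mpoly (@mpolyC n K) b) = Sact rG h b.
    by rewrite /theta /= Sact_left_lift phiK_lift.
  have thetaC a : theta a%:MP = Sact rG g a.
    by rewrite /theta /= Sact_leftC phiKC.
  have thetaX l : theta 'X_l = Sact_var rG h l.
    by rewrite /theta /= Sact_leftX phiKX.
  transitivity (theta (map_mpoly (@mpolyC n K) (tnth f i) - (tnth f i)%:MP)).
    rewrite divided_differencesE (rmorph_sum theta); apply: eq_bigr => l _.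
    apply: etrans (esym (rmorphM theta _ _)); rewrite !mxE; congr (_ * _).
    by apply: etrans (esym (rmorphB theta _ _)); rewrite thetaX thetaC SactX.
  apply: etrans (rmorphB theta _ _) _; rewrite thetaL thetaC.
  by rewrite (invf i h) (invf i g) subrr.
(* The adjugate turns M v = 0 into det(M) v = 0; over a domain a nonzero entry of v then kills the
   determinant. *)
have /matrixP dv : \det M *: v = 0.
  by rewrite -mul_scalar_mx -mul_adj_mx -mulmxA Mv0 mulmx0.
apply/eqP/contraT => nz_det; case/eqP: neq_hg.
apply: (Sact_var_inj faithful_rG) => j; apply/eqP; rewrite -subr_eq0.
have /eqP := dv j ord0; rewrite [(_ *: v) _ _]mxE [v _ _]mxE [X in _ == X]mxE.
by rewrite mulf_eq0 (negPf nz_det).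
Qed.

End DividedDifferences.

Lemma psi_linear : linear (psi rG nabla).
Proof.
move=> a s t; rewrite /psi scaler_sumr -big_split; apply: eq_bigr => g _.
by rewrite MapsE scalerDl scalerA.
Qed.

Lemma phi0 : phi (0 : SRS rG) = 0.
Proof.
by have := phi_linear (-1) 0 (0 : SRS rG); rewrite scaler0 addr0 scaleN1r addNr.
Qed.

Lemma phi_sum (I : Type) (r : seq I) (F : I -> SRS rG) g :
  phi (\sum_(i <- r) F i) g = \sum_(i <- r) (phi (F i) g : S).
Proof.
elim: r => [|i r IHr]; first by rewrite !big_nil phi0 ffunE.
by rewrite !big_cons -IHr -[F i]scale1r phi_linear MapsE scale1r mul1r.
Qed.

Lemma phiZ a (x : SRS rG) g : phi (a *: x) g = a * (phi x g : S).
Proof.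
by rewrite -[a *: x]addr0 phi_linear MapsE phi0 [X in _ + X]ffunE addr0.
Qed.

Lemma phi_psi (nablaP : divided_differences f nabla)
    (faith : mx_faithful rG) (invf : forall i, Sinvariant rG (tnth f i)) s g :
  phi (psi rG nabla s) g = Sact rG g (jacobian f) * s g.
Proof.
rewrite phi_sum (bigD1 g) //= big1 ?addr0 => [|h hg]; rewrite phiZ phi_pi phiK_det_nabla //.
  by rewrite eqxx mul1r mulrC.
by rewrite eq_sym (negPf hg) mul0r mulr0.
Qed.

End Psi.

(** * Invariants of a reflection group *)

Section Invariants.
Variables (K : fieldType) (n : nat) (gT : finGroupType).
Variable rG : mx_representation K [set: gT] n.
Local Notation S := {mpoly K[n]}.
Variable f : n.-tuple S.
Implicit Types (p q r : S) (g h : gT).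

Lemma Sact_mderiv g p k :
  (Sact rG g p)^`M(k) = \sum_j rG g k j *: Sact rG g p^`M(j).
Proof.
rewrite /Sact mderiv_comp; apply: eq_bigr => j _.
rewrite tnth_mktuple /Sact_var (raddf_sum (mderiv k)) /= (bigD1 k) //=.
rewrite big1 ?addr0 => [|i ik].
  by rewrite mderivZ mderivXU eqxx -mul_mpolyC mulr1 mulrC mul_mpolyC.
by rewrite mderivZ mderivXU (negPf ik) scaler0.
Qed.

Lemma Sinvariant_sum_Sact p : Sinvariant rG (\sum_g Sact rG g p).
Proof.
move=> h; rewrite Sact_sum (reindex_inj (mulgI h^-1%g)) /=.
by apply: eq_bigr => g _; rewrite -SactM mulKVg.
Qed.

Lemma Sinvariant_nat k : Sinvariant rG k%:R.
Proof. by move=> g; rewrite Sact_nat. Qed.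

Lemma SinvariantC a : Sinvariant rG a%:MP.
Proof. by move=> g; rewrite SactC. Qed.

Lemma SinvariantD p q : Sinvariant rG p -> Sinvariant rG q -> Sinvariant rG (p + q).
Proof. by move=> ip iq g; rewrite Sact_add ip iq. Qed.

Lemma SinvariantM p q : Sinvariant rG p -> Sinvariant rG q -> Sinvariant rG (p * q).
Proof. by move=> ip iq g; rewrite Sact_mul ip iq. Qed.

Lemma sum_Sact_mull r p : Sinvariant rG r ->
  \sum_g Sact rG g (r * p) = r * \sum_g Sact rG g p.
Proof.
by move=> ir; rewrite mulr_sumr; apply: eq_bigr => g _; rewrite Sact_mul ir.
Qed.

Lemma mcoeff0_Sact g p : (Sact rG g p)@_0 = p@_0.
Proof.
apply: (mpoly_rmorph_ext (h1 := mcoeff 0 \o Sact rG g) (h2 := mcoeff 0)) => [a|j] /=.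
  by rewrite SactC.
rewrite SactX /Sact_var (raddf_sum (mcoeff 0)) mcoeffX mnm1_eq0 big1 // => k _ /=.
by rewrite mcoeffZ mcoeffX mnm1_eq0 mulr0.
Qed.

Lemma meval_Sact g p v :
  (Sact rG g p).@[v] = p.@[fun j => \sum_k rG g k j * v k].
Proof.
rewrite /Sact comp_mpoly_meval; apply: meval_eq => j.
rewrite tnth_mktuple /Sact_var raddf_sum; apply: eq_bigr => k _ /=.
by rewrite mevalZ mevalXU.
Qed.

Hypothesis fP : basic_invariants rG f.

Let fhomog i : exists d, tnth f i \is d.-homog. Proof. by case: fP. Qed.
Let finv i : Sinvariant rG (tnth f i). Proof. by case: fP. Qed.
Let finj : injective (fun q : S => q \mPo f). Proof. by case: fP. Qed.
Let fgen p : Sinvariant rG p -> exists q : S, p = q \mPo f.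
Proof. by case: fP => _ _ _; apply. Qed.

(** Differentiating g f_i = f_i shows that the Jacobian matrix is its own image under g times the
    transpose of [rG g]. This is what [Maps_det_twist] compensates. *)
Lemma det_jacobian g : \det (rG g) *: Sact rG g (jacobian f) = jacobian f.
Proof.
rewrite -mul_mpolyC /jacobian -!det_map_mx mulrC -[in X in _ * X]det_tr -det_mulmx.
congr (\det _); apply/matrixP => i k; rewrite !mxE -[in RHS](finv i g) Sact_mderiv.
by apply: eq_bigr => j _; rewrite !mxE mulrC mul_mpolyC.
Qed.

Lemma Sinvariant_mderiv r : Sinvariant rG r ->
  exists A : 'I_n -> S, forall k, r^`M(k) = \sum_i A i * (tnth f i)^`M(k).
Proof.
by case/fgen => q ->; exists (fun i => q^`M(i) \mPo f) => k; apply: mderiv_comp.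
Qed.

(** The hypothesis expresses each u_k dx_k through the df_i; take determinants. *)
Lemma jacobian_factor (u : 'I_n -> S) (W : 'I_n -> 'I_n -> S) :
  (forall k j, \sum_i W k i * (tnth f i)^`M(j) = u k * (k == j)%:R) ->
  \prod_k u k = \det (\matrix_(k, i) W k i) * jacobian f.
Proof.
move=> WJ; rewrite -det_mulmx.
have -> : \prod_k u k = \det (diag_mx (\row_k u k)).
  by rewrite det_diag; apply: eq_bigr => k _; rewrite mxE.
congr (\det _); apply/matrixP => k j; rewrite !mxE -mulr_natr -WJ.
by apply: eq_bigr => i _; rewrite !mxE.
Qed.

(** The Hilbert ideal; the quotient of S by it is the coinvariant algebra. *)
Definition coinv_ideal p := exists c : 'I_n -> S, p = \sum_j c j * tnth f j.

Lemma coinv_ideal_is_ideal : is_ideal coinv_ideal.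
Proof.
split; first by exists (fun=> 0); rewrite big1 // => j _; rewrite mul0r.
move=> a u v [c ->] [d ->]; exists (fun j => a * c j + d j).
rewrite mulr_sumr -big_split; apply: eq_bigr => j _ /=.
by rewrite mulrDl mulrA.
Qed.

Lemma coinv_idealD p q : coinv_ideal p -> coinv_ideal q -> coinv_ideal (p + q).
Proof. by rewrite -{2}[p]mul1r; apply: (proj2 coinv_ideal_is_ideal). Qed.

Lemma coinv_idealMl a p : coinv_ideal p -> coinv_ideal (a * p).
Proof.
move=> Ip; rewrite -[_ * _]addr0; apply: (proj2 coinv_ideal_is_ideal) => //.
exact: (proj1 coinv_ideal_is_ideal).
Qed.

Lemma coinv_idealMr a p : coinv_ideal p -> coinv_ideal (p * a).
Proof. by rewrite mulrC; apply: coinv_idealMl. Qed.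

Lemma coinv_idealN p : coinv_ideal p -> coinv_ideal (- p).
Proof. by rewrite -mulN1r; apply: coinv_idealMl. Qed.

Lemma coinv_ideal_sum (I : Type) (s : seq I) (F : I -> S) :
  (forall i, coinv_ideal (F i)) -> coinv_ideal (\sum_(i <- s) F i).
Proof.
move=> IF; apply: (big_ind coinv_ideal) => // [|p q]; last exact: coinv_idealD.
exact: (proj1 coinv_ideal_is_ideal).
Qed.

Lemma coinv_ideal_Sact g p : coinv_ideal p -> coinv_ideal (Sact rG g p).
Proof.
case=> c ->; exists (fun j => Sact rG g (c j)); rewrite Sact_sum.
by apply: eq_bigr => j _; rewrite Sact_mul finv.
Qed.

(** A basic invariant of degree 0 would be a constant c, and then the variable X_i and the constant
    c would have the same image under substitution of f, against injectivity. *)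
Lemma basic_invariant_homog i :
  exists2 d, (0 < d)%N & tnth f i \is d.-homog.
Proof.
have [[|d] fd] := fhomog i; last by exists d.+1.
have fC : tnth f i = ((tnth f i)@_0)%:MP.
  apply/mpolyP => m; rewrite mcoeffC; case: eqP => [->|/eqP m0].
    by rewrite mulr1.
  by rewrite mulr0 (dhomog_nemf_coeff fd) // mdeg_eq0.
have /finj eqX : (fun q : S => q \mPo f) 'X_i =
    (fun q : S => q \mPo f) ((tnth f i)@_0)%:MP.
  by rewrite /= comp_mpolyXU -tnth_nth comp_mpolyC.
have /eqP := congr1 (mcoeff U_(i)) eqX.
by rewrite mcoeffXU eqxx mcoeffC mnm1_eq0 mulr0 oner_eq0.
Qed.

Lemma basic_invariant_mcoeff0 i : (tnth f i)@_0 = 0.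
Proof.
have [d d0 fd] := basic_invariant_homog i.
by rewrite (dhomog_nemf_coeff fd) //= mdeg0 eq_sym -lt0n.
Qed.

Lemma coinv_ideal_mcoeff0 p : coinv_ideal p -> p@_0 = 0.
Proof.
case=> c ->; rewrite (raddf_sum (mcoeff 0)) big1 // => j _ /=.
by rewrite (rmorphM (mcoeff 0)) /= basic_invariant_mcoeff0 mulr0.
Qed.

(** For r = q(f), substituting f and taking the constant term are two morphisms in q that agree
    modulo the ideal on variables. *)
Lemma Sinvariant_augment r : Sinvariant rG r -> coinv_ideal (r - (r@_0)%:MP).
Proof.
case/fgen => q ->; pose h2 : {rmorphism S -> S} := @mpolyC n K \o mcoeff 0.
have Iq : coinv_ideal (q \mPo f - h2 q).
  apply: (mpoly_congr (h1 := comp_mpoly f) coinv_ideal_is_ideal) => [a|j].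
    by rewrite /h2 /= mcoeffC eqxx mulr1; exact: comp_mpolyC.
  rewrite /h2 /= mcoeffX mnm1_eq0 comp_mpolyXU -tnth_nth subr0.
  exists (fun i => (i == j)%:R); rewrite (bigD1 j) //= eqxx mul1r.
  by rewrite big1 ?addr0 // => i /negPf ->; rewrite mul0r.
have /eqP := coinv_ideal_mcoeff0 Iq; rewrite raddfB /= mcoeffC eqxx mulr1.
by rewrite subr_eq0 => /eqP ->.
Qed.

End Invariants.

(** * Chevalley's lemma and linear independence over the invariants *)

Section Freeness.
Variables (K : fieldType) (n : nat) (gT : finGroupType).
Variable rG : mx_representation K [set: gT] n.
Local Notation S := {mpoly K[n]}.
Variable f : n.-tuple S.
Implicit Types (p q r u : S) (g h : gT).

Lemma dhomog_linear_form (a : 'I_n -> K) :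
  \sum_k a k *: ('X_k : S) \is 1.-homog.
Proof. by apply: rpred_sum => k _; apply: rpredZ; rewrite dhomogX /= mdeg1. Qed.

Lemma dhomog_leq_msize d p : p \is d.-homog -> (msize p <= d.+1)%N.
Proof.
move=> /dhomogP hp; rewrite msizeE big_seq.
by apply/bigmax_leqP_seq => m mp _; rewrite hp.
Qed.

Lemma msize_Sact_leq g p : (msize (Sact rG g p) <= msize p)%N.
Proof.
rewrite {1}[p]mpolyE raddf_sum big_seq; apply: leq_trans (msize_sum _ _ _) _.
apply/bigmax_leqP_seq => m _ mp /=; rewrite SactZ; apply: leq_trans (msizeZ_le _ _) _.
apply: leq_trans (msize_mdeg_lt mp); apply: dhomog_leq_msize.
rewrite mpolyXE_id rmorph_prod mdegE.
apply: (big_ind2 (fun (q : S) d => q \is d.-homog)) => [|q1 d1 q2 d2|i _].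
- exact: dhomog1.
- exact: dhomogM.
- rewrite rmorphXn /= SactX.
  by have := dhomogMn (m i) (dhomog_linear_form ((rG g)^~ i)); rewrite mul1n.
Qed.

(** The image of 1 - g on V is the line of the eigenvector for zeta, a column of P^-1; l is that
    vector read as a linear form. Hence p and g p agree modulo l. Size 2 means degree 1. *)
Lemma pseudo_reflection_form g : pseudo_reflection rG g ->
  exists2 l : S, l != 0 /\ msize l = 2 & forall p, exists q, p - Sact rG g p = q * l.
Proof.
case=> n_gt0 [zeta [P [_ _ unitP rGE]]]; pose o : 'I_n := Ordinal n_gt0.
pose Q := invmx P; pose l : S := \sum_k Q k o *: 'X_k.
have nz_l : l != 0.
  apply/eqP => l0; have /matrixP/(_ o o) := mulmxV unitP.
  rewrite mxE big1 ?mxE ?eqxx => [/esym/eqP|k _]; first by rewrite oner_eq0.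
  have /(congr1 (mcoeff U_(k))) := l0; rewrite /l (raddf_sum (mcoeff _)) mcoeff0.
  rewrite (bigD1 k) //= mcoeffZ mcoeffXU eqxx mulr1 big1 ?addr0 => [->|i ik].
    by rewrite mulr0.
  by rewrite mcoeffZ mcoeffXU (negPf ik) mulr0.
exists l; first split=> //.
  apply/eqP; rewrite eqn_leq dhomog_leq_msize ?dhomog_linear_form //=.
  rewrite ltnNge; apply/negP => /msize1_polyC lC; case/eqP: nz_l; rewrite lC.
  by rewrite (dhomog_nemf_coeff (dhomog_linear_form _)) ?mpolyC0 //= mdeg0.
pose I p := exists q, p = q * l.
have idI : is_ideal I.
  split; first by exists 0; rewrite mul0r.
  by move=> a u v [c ->] [d ->]; exists (a * c + d); rewrite mulrDl mulrA.
apply: (mpoly_congr (h1 := idfun) (h2 := Sact rG g) idI) => [a|j] /=.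
  by rewrite SactC.
exists ((1 - zeta) * P o j)%:MP; rewrite SactX /Sact_var /l mulr_sumr.
have -> : 'X_j = \sum_k (1%:M : 'M[K]_n) k j *: ('X_k : S).
  rewrite (bigD1 j) //= mxE eqxx scale1r big1 ?addr0 // => k /negPf kj.
  by rewrite mxE kj scale0r.
rewrite -sumrB; apply: eq_bigr => k _; rewrite -scalerBl mul_mpolyC scalerA.
have -> : rG g = Q *m diag_mx (\row_i (if (i : nat) == 0%N then zeta else 1)) *m P.
  by rewrite -rGE !mulmxA mulVmx // mul1mx mulmxKV.
have -> : 1%:M = Q *m 1%:M *m P :> 'M[K]_n by rewrite mulmx1 mulVmx.
have -> : forall A B : 'M[K]_n, A k j - B k j = (A - B) k j.
  by move=> A B; rewrite !mxE.
rewrite -mulmxBl -mulmxBr mxE (bigD1 o) //= big1 ?addr0 => [|i io].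
  rewrite mxE (bigD1 o) //= big1 ?addr0 => [|i io].
    by rewrite !mxE !eqxx /= mulr1n -mulrA mulrC; congr (_ *: _).
  by rewrite !mxE (negPf io) !mulr0n subrr mulr0.
rewrite mxE big1 ?mul0r // => i' _; rewrite !mxE; case: eqP => [->|_].
  by rewrite (negPf (io : (i : nat) != 0%N)) subrr mulr0.
by rewrite !mulr0n subrr mulr0.
Qed.

Hypothesis fP : basic_invariants rG f.
Hypothesis genG : generated_by_pseudo_reflections rG.
Hypothesis charK : #|gT|%:R != 0 :> K.

(** The ideal is stable under G, so the elements fixing p modulo it form a subgroup. *)
Lemma coinv_generators p :
  (forall g, pseudo_reflection rG g -> coinv_ideal f (p - Sact rG g p)) ->
  forall g, coinv_ideal f (p - Sact rG g p).
Proof.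
move=> Ip; case: genG => T reflT genT.
have grpH : group_set [set g | `[< coinv_ideal f (p - Sact rG g p) >]].
  apply/group_setP; split=> [|g h].
    by rewrite inE Sact1 subrr; apply/asboolP; case: (coinv_ideal_is_ideal f).
  rewrite !inE => /asboolP Ig /asboolP Ih; apply/asboolP.
  have -> : p - Sact rG (g * h) p = (p - Sact rG g p) + Sact rG g (p - Sact rG h p).
    by rewrite SactM rmorphB /= addrA subrK.
  by apply: coinv_idealD => //; apply: (coinv_ideal_Sact fP).
have sTH : T \subset Group grpH.
  by apply/subsetP => g /reflT/Ip Ig; rewrite inE; apply/asboolP.
move=> g; apply/asboolP; have : g \in Group grpH.
  by apply: (subsetP (_ : <<T>> \subset _)%g); rewrite ?gen_subG // genT inE.
by rewrite inE.
Qed.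

(** p is the average of the p - g p plus the average of the g p; the latter is an invariant without
    constant term. *)
Lemma coinv_Reynolds p :
  (forall g, coinv_ideal f (p - Sact rG g p)) ->
  (\sum_g Sact rG g p)@_0 = 0 -> coinv_ideal f p.
Proof.
move=> Ip tr0; pose c : K := #|gT|%:R.
have -> : p = (c^-1)%:MP * (\sum_g (p - Sact rG g p) + \sum_g Sact rG g p).
  rewrite -big_split /= (eq_bigr (fun=> p)) => [|g _]; last by rewrite subrK.
  rewrite sumr_const -[X in p *+ X]/#|gT| -mulr_natr -/c mulrCA -mpolyC_nat -/c.
  by rewrite -mpolyCM mulVf // mulr1.
apply: coinv_idealMl; apply: coinv_idealD; first exact: coinv_ideal_sum.
have := Sinvariant_augment fP (Sinvariant_sum_Sact rG p).
by rewrite tr0 mpolyC0 subr0.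
Qed.

(* Chevalley's lemma with the invariants localized at their augmentation ideal,
   which removes all homogeneity assumptions. *)
Lemma chevalley m (r p : 'I_m -> S) r1 p1 :
  Sinvariant rG r1 -> (forall i, Sinvariant rG (r i)) ->
  (forall u (t : 'I_m -> S), Sinvariant rG u -> (forall i, Sinvariant rG (t i)) ->
     u * r1 = \sum_i t i * r i -> u@_0 = 0) ->
  r1 * p1 + \sum_i r i * p i = 0 -> coinv_ideal f p1.
Proof.
move=> inv1 invr indep; have [k] := ubnP (msize p1).
elim: k => // k IHk in p p1 * => /ltnSE le_p1k rel.
apply: coinv_Reynolds.
  apply: coinv_generators => g /pseudo_reflection_form[l [nz_l size_l] lP].
  (* Subtracting from the relation its image under g and cancelling l gives the same relation
     between the quotients, where [q1] has smaller degree than [p1]. *)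
  have [q1 q1P] := lP p1; have /choice[q qP] i := lP (p i).
  have Iq1 : coinv_ideal f q1.
    have [->|nz_q1] := eqVneq q1 0; first by case: (coinv_ideal_is_ideal f).
    apply: (IHk q q1).
      have := msizeM nz_q1 nz_l; rewrite size_l addn2 /= -q1P => sz.
      apply: leq_trans le_p1k; rewrite -sz; apply: leq_trans (msizeD_le _ _) _.
      by rewrite geq_max leqnn msizeN msize_Sact_leq.
    apply/eqP; rewrite -(mulIr_eq0 _ (mulIf nz_l)) mulrDl -mulrA -q1P mulr_suml.
    rewrite (eq_bigr (fun i => r i * p i - r i * Sact rG g (p i))); last first.
      by move=> i _; rewrite -mulrA -qP mulrBr.
    rewrite sumrB mulrBr addrACA rel add0r -opprD oppr_eq0.
    have /(congr1 (Sact rG g)) := rel; rewrite rmorph0 => {2}<-.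
    rewrite Sact_add Sact_mul inv1 Sact_sum; apply/eqP; congr (_ + _).
    by apply: eq_bigr => i _; rewrite Sact_mul invr.
  by rewrite q1P; apply: coinv_idealMr.
have trD q q' : \sum_g Sact rG g (q + q') = \sum_g Sact rG g q + \sum_g Sact rG g q'.
  by rewrite -big_split; apply: eq_bigr => g _; rewrite Sact_add.
(* Averaging the relation over G makes the sum of the g p1 an invariant multiplier carrying [r1]
   into the span of the r_i, so [indep] kills its constant term. *)
apply: (indep _ (fun i => - \sum_g Sact rG g (p i))).
- exact: Sinvariant_sum_Sact.
- move=> i; rewrite -mulN1r; apply: SinvariantM; last exact: Sinvariant_sum_Sact.
  by move=> g; rewrite rmorphN1.
- have /(congr1 (fun q => \sum_g Sact rG g q)) := rel.
  rewrite trD sum_Sact_mull // mulrC.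
  have -> : \sum_g Sact rG g 0 = 0 by apply: big1 => g _; apply: rmorph0.
  move=> /eqP; rewrite addr_eq0 => /eqP ->; rewrite -sumrN.
  rewrite (eq_bigr (fun g => - \sum_i r i * Sact rG g (p i))); last first.
    by move=> g _; rewrite Sact_sum; congr (- _); apply: eq_bigr => i _; rewrite Sact_mul invr.
  rewrite sumrN exchange_big -sumrN; apply: eq_bigr => i _ /=.
  by rewrite -mulr_sumr mulNr mulrC.
Qed.

(** Independence over K modulo the Hilbert ideal lifts to independence over the invariants, by
    induction on the number of elements: Chevalley's lemma provides a dependence between the
    coefficients which eliminates one of them. *)
Lemma coinv_indep_free N (e r : 'I_N -> S) :
  (forall c : 'I_N -> K, coinv_ideal f (\sum_i c i *: e i) -> forall i, c i = 0) ->
  (forall i, Sinvariant rG (r i)) -> \sum_i r i * e i = 0 -> forall i, r i = 0.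
Proof.
elim: N e r => [|N IHN] e r indep invr rel; first by case.
have I0 := proj1 (coinv_ideal_is_ideal f).
pose dep u (t : 'I_N -> S) := [/\ Sinvariant rG u, forall i, Sinvariant rG (t i),
  u * r ord0 = \sum_i t i * r (lift ord0 i) & u@_0 != 0].
(* If no such dependence exists, Chevalley's lemma puts e_0 in the ideal. Otherwise the relation
   times u becomes one between the elements u e_(i+1) + t_i e_0, which modulo the ideal are u(0)
   e_(i+1) + t_i(0) e_0 and so still independent. *)
have [[u [t [invu invt utr nz_u]]]|ndep] := pselect (exists u t, dep u t); last first.
  have /(indep (fun i => (i == ord0)%:R)) : coinv_ideal f (\sum_i (i == ord0)%:R *: e i).
    rewrite (bigD1 ord0) //= big1 ?addr0 => [|i /negPf ->]; last first.
      by rewrite scale0r.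
    move: rel; rewrite scale1r big_ord_recl; apply: chevalley => // u t iu it utr.
    by apply/eqP/contraT => nz_u; case: ndep; exists u, t.
  by move/(_ ord0)/eqP; rewrite eqxx oner_eq0.
have modC v : Sinvariant rG v -> forall p, coinv_ideal f (v * p - v@_0 *: p).
  move=> iv p; rewrite -mul_mpolyC -mulrBl; apply: coinv_idealMr.
  exact: (Sinvariant_augment fP).
have r'0 i : r (lift ord0 i) = 0.
  apply: (IHN (fun i => u * e (lift ord0 i) + t i * e ord0) (r \o lift ord0)) => //=.
    move=> c Ic k; pose C j := if unlift ord0 j is Some i then c i * u@_0
                                else \sum_i c i * (t i)@_0.
    have : coinv_ideal f (\sum_j C j *: e j).
      rewrite big_ord_recl /C unlift_none.
      under [X in _ + X]eq_bigr => i' _ do rewrite liftK.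
      rewrite scaler_suml -big_split /=.
      rewrite -[\sum_i _](subrK (\sum_i c i *: (u * e (lift ord0 i) + t i * e ord0))).
      apply: coinv_idealD => //; rewrite -sumrB; apply: coinv_ideal_sum => i' /=.
      rewrite -!scalerA -scalerDr -scalerBr -mul_mpolyC; apply: coinv_idealMl.
      rewrite [X in X - _]addrC opprD addrACA.
      by apply: coinv_idealD; rewrite -opprB; apply: coinv_idealN; apply: modC.
    move/indep/(_ (lift ord0 k))/eqP; rewrite /C liftK mulf_eq0 (negPf nz_u) orbF.
    by move/eqP.
  have -> : \sum_i r (lift ord0 i) * (u * e (lift ord0 i) + t i * e ord0) =
      u * \sum_i r i * e i; last by rewrite rel mulr0.
  rewrite big_ord_recl mulrDr mulrA utr mulr_suml mulr_sumr -big_split.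
  by apply: eq_bigr => i' _ /=; rewrite mulrDr addrC mulrCA !mulrA [r _ * t _]mulrC.
have r00 : r ord0 = 0.
  apply/eqP; have /eqP := utr; rewrite big1 => [|i _]; last by rewrite r'0 mulr0.
  rewrite mulf_eq0 => /orP[/eqP u0|//]; by rewrite u0 mcoeff0 eqxx in nz_u.
by move=> i; case: (unliftP ord0 i) => [j|] ->.
Qed.

(** Repetitions are removed so that x_j is a simple root of [orbit_poly j], with nonzero derivative
    there. *)
Definition var_orbit j : seq S := undup [seq Sact rG g 'X_j | g <- enum gT].

Definition orbit_poly j : {poly S} := \prod_(s <- var_orbit j) ('X - s%:P).

Lemma mem_var_orbit g j : Sact rG g 'X_j \in var_orbit j.
Proof. by rewrite mem_undup; apply: (map_f (fun h => Sact rG h 'X_j)); rewrite mem_enum. Qed.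

Lemma Sact_inj g : injective (Sact rG g).
Proof.
by apply: (can_inj (g := Sact rG g^-1%g)) => p; rewrite -SactM mulVg Sact1.
Qed.

Lemma Sinvariant_orbit_poly j i : Sinvariant rG (orbit_poly j)`_i.
Proof.
move=> h; rewrite -coef_map /orbit_poly rmorph_prod /=; congr ((_ : {poly S})`_i).
transitivity (\prod_(s <- map (Sact rG h) (var_orbit j)) ('X - s%:P)).
  by rewrite big_map; apply: eq_bigr => s _; rewrite rmorphB /= map_polyX map_polyC.
apply: perm_big.
have uniq_hO : uniq (map (Sact rG h) (var_orbit j)).
  by rewrite map_inj_uniq ?undup_uniq //; apply: Sact_inj.
apply: uniq_perm => //; first exact: undup_uniq.
have [] // := uniq_min_size uniq_hO (s2 := var_orbit j); last by rewrite size_map.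
move=> s /mapP[s']; rewrite mem_undup => /mapP[g _ ->] ->.
by rewrite -SactM mem_var_orbit.
Qed.

Lemma orbit_poly_root j : root (orbit_poly j) 'X_j.
Proof. by rewrite root_prod_XsubC -[X in X \in _](Sact1 rG) mem_var_orbit. Qed.

(** All roots of the monic [orbit_poly j] have constant term 0, so its lower coefficients are
    invariants without constant term and lie in the ideal. *)
Lemma coinv_ideal_power j : coinv_ideal f ('X_j ^+ size (var_orbit j)).
Proof.
have size_Q : size (orbit_poly j) = (size (var_orbit j)).+1.
  exact: size_prod_XsubC.
have Q0 : map_poly (mcoeff 0) (orbit_poly j) = 'X^(size (var_orbit j)).
  rewrite /orbit_poly rmorph_prod /= (eq_big_seq (fun=> 'X)) => [|s].
    by rewrite big_const_seq count_predT iter_mulr_1.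
  rewrite mem_undup => /mapP[g _ ->]; rewrite rmorphB /= map_polyX map_polyC /=.
  by rewrite mcoeff0_Sact mcoeffX mnm1_eq0 subr0.
have lead1 : (orbit_poly j)`_(size (var_orbit j)) = 1.
  have := monic_prod_XsubC (var_orbit j) xpredT id; rewrite monicE lead_coefE -/(orbit_poly j).
  by rewrite size_Q => /eqP.
have := orbit_poly_root j; rewrite rootE horner_coef size_Q big_ord_recr /=.
rewrite lead1 mul1r addrC addr_eq0 => /eqP ->; apply: coinv_idealN.
apply: coinv_ideal_sum => i; apply: coinv_idealMr.
have := Sinvariant_augment fP (Sinvariant_orbit_poly j i).
have -> : ((orbit_poly j)`_i)@_0 = 0; last by rewrite mpolyC0 subr0.
by rewrite -(coef_map (mcoeff 0)) Q0 coefXn ltn_eqF.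
Qed.

End Freeness.

(** * A finite basis of S over the invariants *)

Section Basis.
Variables (K : fieldType) (n : nat) (gT : finGroupType).
Variable rG : mx_representation K [set: gT] n.
Local Notation S := {mpoly K[n]}.
Variable f : n.-tuple S.
Implicit Types (p q r u : S) (g h : gT).
Hypothesis fP : basic_invariants rG f.

Lemma coinv_ideal_cofinite : exists B, forall m : 'X_{1..n},
  (exists j, (B <= m j)%N) -> coinv_ideal f 'X_[m].
Proof.
exists (\max_j size (var_orbit rG j))%N => m [j le_Bm].
have le_jm : (size (var_orbit rG j) <= m j)%N.
  by apply: leq_trans le_Bm; apply: (leq_bigmax j).
rewrite mpolyXE_id (bigD1 j) //= -(subnK le_jm) exprD -mulrA mulrC -mulrA.
by apply: coinv_idealMr; apply: coinv_ideal_power.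
Qed.

(** The monomials with all exponents below B span modulo the ideal, and a minimal spanning subset of
    them is independent. Monomials, rather than arbitrary elements, are wanted because they are
    homogeneous. *)
Lemma coinv_monomial_basis : exists N (m : 'I_N -> 'X_{1..n}),
  (forall p, exists c : 'I_N -> K, coinv_ideal f (p - \sum_i c i *: 'X_[m i])) /\
  (forall c : 'I_N -> K, coinv_ideal f (\sum_i c i *: 'X_[m i]) -> forall i, c i = 0).
Proof.
have [B cofin] := coinv_ideal_cofinite.
have I0 := proj1 (coinv_ideal_is_ideal f).
pose F := {ffun 'I_n -> 'I_B}; pose mon (a : F) : 'X_{1..n} := [multinom (a i : nat) | i < n].
pose spans (E : {set F}) := `[< forall p, exists c : F -> K,
  coinv_ideal f (p - \sum_(a in E) c a *: 'X_[mon a]) >].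
have spanT : spans setT.
  apply/asboolP; elim/mpolyind => [|c m p _ _ [d Id]].
    by exists (fun=> 0); rewrite big1 ?subrr // => a _; rewrite scale0r.
  suff [e Ie] : exists e : F -> K, coinv_ideal f ('X_[m] - \sum_(a in setT) e a *: 'X_[mon a]).
    exists (fun a => c * e a + d a).
    under eq_bigr => a _ do rewrite scalerDl -scalerA.
    rewrite big_split -scaler_sumr opprD addrACA -scalerBr.
    by apply: coinv_idealD => //; rewrite -mul_mpolyC; apply: coinv_idealMl.
  have [[j le_Bm]|small] := pselect (exists j, (B <= m j)%N).
    exists (fun=> 0); rewrite big1 ?subr0 => [|a _]; last by rewrite scale0r.
    by apply: cofin; exists j.
  have lt_mB j : (m j < B)%N by rewrite ltnNge; apply/negP => ?; case: small; exists j.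
  pose a : F := [ffun j => Ordinal (lt_mB j)].
  have ma : mon a = m by apply/mnmP => j; rewrite mnmE ffunE.
  exists (fun b => (b == a)%:R); rewrite (bigD1 a) ?inE //= eqxx scale1r ma.
  by rewrite big1 ?addr0 ?subrr // => b /andP[_ /negPf ->]; rewrite scale0r.
have [E /minsetP[/asboolP spanE minE] _] := minset_exists spanT.
have indepE (c : F -> K) : coinv_ideal f (\sum_(a in E) c a *: 'X_[mon a]) ->
    forall a, a \in E -> c a = 0.
  move=> Ic k Ek; apply/eqP/contraT => nz_ck.
  have spanD : spans (E :\ k).
    apply/asboolP => p; have [d Id] := spanE p.
    exists (fun a => d a - d k / c k * c a).
    have -> : \sum_(a in E :\ k) (d a - d k / c k * c a) *: 'X_[mon a] =
       \sum_(a in E) d a *: 'X_[mon a] - (d k / c k) *: \sum_(a in E) c a *: 'X_[mon a].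
      rewrite scaler_sumr -sumrB [RHS](bigD1 k) //= scalerA divfK // subrr add0r.
      apply: eq_big => [a|a _]; first by rewrite !inE andbC.
      by rewrite scalerBl scalerA.
    rewrite opprB addrCA addrC; apply: coinv_idealD => //.
    by rewrite -mul_mpolyC; apply: coinv_idealMl.
  have /setP/(_ k) := minE _ spanD (subD1set _ _).
  by rewrite !inE eqxx Ek.
exists #|E|, (fun i => mon (enum_val i)); split=> [p|c Ic i].
  have [c Ic] := spanE p; exists (fun i => c (enum_val i)).
  by rewrite -(big_enum_val (fun a => c a *: 'X_[mon a])).
pose c' a := \sum_(j < #|E| | enum_val j == a) c j.
have c'E j : c' (enum_val j) = c j.
  by rewrite /c' (big_pred1 j) // => l; rewrite (inj_eq enum_val_inj).
rewrite -c'E; apply: indepE; last exact: enum_valP.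
rewrite (big_enum_val (fun a => c' a *: 'X_[mon a])) /=.
by under eq_bigr => j _ do rewrite c'E.
Qed.

Hypothesis genG : generated_by_pseudo_reflections rG.
Hypothesis charK : #|gT|%:R != 0 :> K.

Definition invariant_basis N (e : 'I_N -> S) :=
  (forall p, exists2 r : 'I_N -> S,
     forall i, Sinvariant rG (r i) & p = \sum_i r i * e i) /\
  (forall r : 'I_N -> S, (forall i, Sinvariant rG (r i)) ->
     \sum_i r i * e i = 0 -> forall i, r i = 0).

(** Graded Nakayama: in degree d, an element is a combination of the monomials plus a sum of s_i
    f_i, where only components of s_i of degree below d matter because each f_i has positive
    degree. *)
Lemma exists_invariant_basis : exists N (e : 'I_N -> S), invariant_basis e.
Proof.
have [N [m [spanm indepm]]] := coinv_monomial_basis.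
exists N, (fun i => 'X_[m i]); split; last first.
  by move=> r invr; apply: (coinv_indep_free fP genG charK indepm invr).
pose spanned p := exists2 r : 'I_N -> S,
     forall i, Sinvariant rG (r i) & p = \sum_i r i * 'X_[m i].
have spanned0 : spanned 0.
  by exists (fun=> 0) => [i g|]; rewrite ?rmorph0 // big1 // => i _; rewrite mul0r.
have spannedD p q : spanned p -> spanned q -> spanned (p + q).
  move=> [r ir ->] [s is_ ->]; exists (fun i => r i + s i).
    by move=> i; apply: SinvariantD.
  by rewrite -big_split; apply: eq_bigr => i _; rewrite mulrDl.
have spannedM r p : Sinvariant rG r -> spanned p -> spanned (r * p).
  move=> invr [s is_ ->]; exists (fun i => r * s i).
    by move=> i; apply: SinvariantM.
  by rewrite mulr_sumr; apply: eq_bigr => i _; rewrite mulrA.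
have spanned_sum (I : Type) (s : seq I) (F : I -> S) (P : pred I) :
    (forall i, P i -> spanned (F i)) -> spanned (\sum_(i <- s | P i) F i).
  by move=> sF; apply: (big_ind spanned).
have spannedX i : spanned 'X_[m i].
  exists (fun j => (j == i)%:R) => [j|]; first exact: Sinvariant_nat.
  rewrite (bigD1 i) //= eqxx mul1r big1 ?addr0 // => j /negPf ->.
  by rewrite mul0r.
have spannedC c p : spanned p -> spanned (c *: p).
  by rewrite -mul_mpolyC; apply: spannedM; apply: SinvariantC.
have homs d : forall p, p \is d.-homog -> spanned p.
  elim/ltn_ind: d => d IHd p pd.
  have [c [s /eqP]] := spanm p; rewrite subr_eq => /eqP Ep.
  rewrite -(pihomog_dE pd) Ep pihomogD !raddf_sum.
  apply: (spannedD); apply: (spanned_sum) => i _ /=; last first.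
    rewrite linearZ /= pihomogX; case: eqP => _; last by rewrite scaler0.
    exact: spannedC.
  have [di di0 fi] := basic_invariant_homog fP i.
  rewrite [s i](pihomog_partitionE (mf := mdeg) (leqnn _)) mulr_suml raddf_sum.
  apply: (spanned_sum) => l _ /=.
  have hom : pihomog mdeg l (s i) * tnth f i \is (l + di).-homog.
    by apply: dhomogM => //; apply: pihomogP.
  have [dE|ne_d] := eqVneq (l + di)%N d; last by rewrite (pihomog_ne0 ne_d).
  rewrite pihomog_dE -?dE // mulrC; apply: spannedM; first by case: fP.
  by apply: (IHd l); [rewrite -dE -[X in (X < _)%N]addn0 ltn_add2l | apply: pihomogP].
move=> p; rewrite [p](pihomog_partitionE (mf := mdeg) (leqnn _)).
by apply: (spanned_sum) => d _; apply: (homs d); apply: pihomogP.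
Qed.

End Basis.

Lemma derivation_horner (B : comNzRingType) (d : {additive B -> B}) (Q : {poly B}) x :
  (forall a b, d (a * b) = d a * b + a * d b) ->
  d Q.[x] = (\sum_(i < size Q) d Q`_i * x ^+ i) + Q^`().[x] * d x.
Proof.
move=> dM; rewrite -(horner_poly (size Q) (fun i => d Q`_i)) -/(map_poly d Q).
elim/poly_ind: Q => [|Q c IHQ].
  by rewrite raddf0 deriv0 !horner0 raddf0 mul0r addr0.
have -> : map_poly d (Q * 'X + c%:P) = map_poly d Q * 'X + (d c)%:P.
  rewrite raddfD /= map_polyC; congr (_ + _); apply/polyP => i.
  by rewrite coef_map !coefMX coef_map; case: eqP => // _; apply: raddf0.
rewrite derivD derivC addr0 derivM derivX mulr1 !hornerMXaddC hornerD hornerMX.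
rewrite raddfD dM IHQ mulrDl mulrDl -!addrA [in LHS]mulrAC; congr (_ + _).
by rewrite [RHS]addrC addrA.
Qed.

(** * Linear factors of the Jacobian *)

Section JacobianFactors.
Variables (K : fieldType) (n : nat) (gT : finGroupType).
Variable rG : mx_representation K [set: gT] n.
Local Notation S := {mpoly K[n]}.
Variable f : n.-tuple S.
Hypothesis fP : basic_invariants rG f.

Definition orbit_diff j : S := \prod_(s <- var_orbit rG j | s != 'X_j) ('X_j - s).

Lemma orbit_diff_deriv j : (orbit_poly rG j)^`().['X_j] = orbit_diff j.
Proof.
have Xj : 'X_j \in var_orbit rG j by rewrite -[X in X \in _](Sact1 rG) mem_var_orbit.
rewrite /orbit_poly (bigD1_seq _ Xj) ?undup_uniq //= derivM derivXsubC mul1r.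
rewrite hornerD hornerM hornerXsubC subrr mul0r addr0 horner_prod.
by apply: eq_bigr => s _; rewrite hornerXsubC.
Qed.

(* Differentiate F(x_j) = 0, where F is the orbit polynomial of x_j: its
   coefficients are invariant, so their differentials are combinations of the df_i. *)
Lemma jacobian_dvd_orbit_diff : exists w, \prod_j orbit_diff j = w * jacobian f.
Proof.
suff /choice[W WP] : forall j, exists W : 'I_n -> S, forall k,
    \sum_i W i * (tnth f i)^`M(k) = orbit_diff j * (j == k)%:R.
  by exists (\det (\matrix_(j, i) W j i)); apply: jacobian_factor.
move=> j; have /choice[A AP] i := Sinvariant_mderiv fP (Sinvariant_orbit_poly rG j i).
exists (fun i => - \sum_(l < size (orbit_poly rG j)) A l i * 'X_j ^+ l) => k.
have := derivation_horner (orbit_poly rG j) 'X_j (mderivM k).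
rewrite (rootP (orbit_poly_root rG j)) raddf0 /= orbit_diff_deriv mderivXU.
move/esym/eqP; rewrite addrC addr_eq0 => /eqP ->; rewrite -sumrN.
under eq_bigr => i _ do rewrite mulNr mulr_suml -sumrN.
rewrite exchange_big; apply: eq_bigr => l _ /=; rewrite AP mulr_suml -sumrN.
by apply: eq_bigr => i _; rewrite mulrAC.
Qed.

Definition linear_form (a : 'rV[K]_n) : S := \sum_k a 0 k *: 'X_k.

Lemma linear_form_neq0 a : (linear_form a != 0) = (a != 0).
Proof.
apply/idP/idP.
  apply: contra_neq => ->.
  by rewrite /linear_form big1 // => k _; rewrite mxE scale0r.
apply: contra_neq => la0; apply/rowP => k; have /(congr1 (mcoeff U_(k))) := la0.
rewrite /linear_form (raddf_sum (mcoeff _)) mcoeff0 mxE (bigD1 k) //= mcoeffZ.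
rewrite mcoeffXU eqxx mulr1 big1 ?addr0 // => i ik.
by rewrite mcoeffZ mcoeffXU (negPf ik) mulr0.
Qed.

Lemma jacobian_dvd_linear_forms : exists (s : seq 'rV[K]_n) (w : S),
  (forall a, a \in s -> a != 0) /\ \prod_(a <- s) linear_form a = w * jacobian f.
Proof.
pose split p := exists2 s : seq 'rV[K]_n, (forall a, a \in s -> a != 0) &
  p = \prod_(a <- s) linear_form a.
have split1 : split 1 by exists [::]; rewrite ?big_nil.
have splitM p q : split p -> split q -> split (p * q).
  move=> [s s0 ->] [t t0 ->]; exists (s ++ t); last by rewrite big_cat.
  by move=> a; rewrite mem_cat => /orP[/s0|/t0].
have [s s0 sE] : split (\prod_j orbit_diff j).
  apply: (big_ind split) => // j _; rewrite /orbit_diff big_seq_cond.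
  apply: (big_ind split) => // s /andP[].
  rewrite mem_undup => /mapP[g _ ->] neq_gj.
  have lE : 'X_j - Sact rG g 'X_j = linear_form (\row_k ((k == j)%:R - rG g k j)).
    rewrite SactX /Sact_var /linear_form.
    under [RHS]eq_bigr => k _ do rewrite mxE scalerBl.
    rewrite sumrB; congr (_ - _); rewrite (bigD1 j) //= eqxx scale1r big1 ?addr0 //.
    by move=> k /negPf ->; rewrite scale0r.
  exists [:: \row_k ((k == j)%:R - rG g k j)]; last by rewrite big_seq1.
  by move=> a; rewrite inE => /eqP ->; rewrite -linear_form_neq0 -lE subr_eq0 eq_sym.
have [w wE] := jacobian_dvd_orbit_diff; exists s, w; split=> //.
by rewrite -sE wE.
Qed.

Lemma jacobian_neq0 : jacobian f != 0.
Proof.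
have [s [w [s0 sE]]] := jacobian_dvd_linear_forms.
have : \prod_(a <- s) linear_form a != 0.
  by rewrite prodf_seq_neq0; apply/allP => a /s0 /=; rewrite linear_form_neq0.
by apply: contra_neq => J0; rewrite sE J0 mulr0.
Qed.

End JacobianFactors.

(** * The matrix factorization and its cokernel *)

Section MatrixFactorization.
Variables (K : fieldType) (n : nat) (gT : finGroupType).
Variable rG : mx_representation K [set: gT] n.
Local Notation S := {mpoly K[n]}.
Local Notation SS := {mpoly S[n]}.
Variable f : n.-tuple S.
Variable nabla : 'I_n -> 'I_n -> SS.
Hypothesis fP : basic_invariants rG f.
Hypothesis genG : generated_by_pseudo_reflections rG.
Hypothesis charK : #|gT|%:R != 0 :> K.
Hypothesis faithful_rG : mx_faithful rG.
Hypothesis nablaP : divided_differences f nabla.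
Let invf i : Sinvariant rG (tnth f i). Proof. by case: fP. Qed.

(* Writing det nabla = sum_m d_m (x) x^m, one has sum_m d_m tr(x^m c) = J c, and
   the hypothesis forces tr(x^m c_i) = 0 by independence of e over the invariants. *)
Lemma invariant_basis_nondegenerate N (e : 'I_N -> S) (c : 'I_N -> S) :
  invariant_basis rG e -> (forall g, \sum_i c i * Sact rG g (e i) = 0) ->
  forall i, c i = 0.
Proof.
case=> _ indep ce0.
(* Multiply the hypothesis at h^-1 by u and apply h: this gives sum_j h(u c_j) e_j = 0. Summing over
   h yields a relation between the e_j with invariant coefficients. *)
have tr0 u i : \sum_h Sact rG h (u * c i) = 0.
  apply: (indep (fun i => \sum_h Sact rG h (u * c i))) => [j|].
    exact: Sinvariant_sum_Sact.
  under eq_bigr => j _ do rewrite mulr_suml.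
  rewrite exchange_big big1 // => h _ /=.
  have /(congr1 (fun q => Sact rG h (u * q))) := ce0 h^-1%g.
  rewrite mulr0 rmorph0 => {2}<-; rewrite mulr_sumr Sact_sum.
  apply: eq_bigr => j _; rewrite !Sact_mul -SactM mulgV Sact1.
  by rewrite mulrA.
(* [D] evaluates to J at the identity and to 0 at every other h, so pairing it with the h(c_i)
   isolates J c_i. *)
move=> i; pose D := \det (\matrix_(i, j) Sact_left rG 1%g (nabla i j)).
have DE h : phiK rG h D = (h == 1%g)%:R * jacobian f.
  by rewrite (phiK_det_nabla nablaP faithful_rG invf) Sact1.
apply/eqP; rewrite -(mulIr_eq0 _ (mulIf (jacobian_neq0 fP))); apply/eqP.
transitivity (\sum_h Sact rG h (c i) * phiK rG h D).
  rewrite (bigD1 1%g) //= big1 => [|h /negPf h1].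
    by rewrite addr0 DE eqxx mul1r Sact1.
  by rewrite DE h1 mul0r mulr0.
transitivity (\sum_(m <- msupp D) D@_m * \sum_h Sact rG h ('X_[m] * c i)).
  under [RHS]eq_bigr => m _ do rewrite mulr_sumr.
  rewrite exchange_big; apply: eq_bigr => h _ /=.
  rewrite {1}(tensK_sum D) (rmorph_sum (phiK rG h)) mulr_sumr.
  apply: eq_bigr => m _ /=; rewrite phiK_tens Sact_mul.
  by rewrite mulrCA [X in _ * X]mulrC.
by rewrite big1 // => m _; rewrite tr0 mulr0.
Qed.

Lemma tensR_balanced a r b : Sinvariant rG r ->
  tensR rG a (r * b) = tensR rG (a * r) b.
Proof.
move=> invr; apply/quotmod_eqP; apply: mem_submod_gen.
exists (tensK a b), r; split=> //.
apply: etrans (esym (mulrBr _ _ _)); congr (_ - _).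
  by rewrite tensK_mul mulr1 mulrC.
by rewrite tensK_mul mulr1.
Qed.

Lemma tensRZ a b c : tensR rG (a * b) c = a *: tensR rG b c.
Proof.
rewrite /tensR; have -> : tensK (a * b) c = a *: tensK b c.
  exact: esym (scalerA _ _ _).
have := @quotmod_pi_linear _ _ (@tensR_rel K n gT rG) a (tensK b c) 0.
by rewrite addr0 => ->; rewrite [X in _ + X](raddf0 (\pi_(SRS rG))) addr0.
Qed.

Lemma SRS_sum (x : SRS rG) :
  x = \sum_(m <- msupp (repr x)) (repr x)@_m *: tensR rG 1 'X_[m].
Proof.
rewrite -[LHS]reprK {1}(tensK_sum (repr x)).
have pi_sum (I : Type) (s : seq I) (F : I -> SS) :
    \pi_(SRS rG) (\sum_(i <- s) F i) = \sum_(i <- s) (\pi_(SRS rG) (F i) : SRS rG).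
  elim: s => [|i s IHs]; rewrite ?big_nil; first exact: raddf0.
  by rewrite !big_cons -IHs; exact: raddfD.
by rewrite pi_sum; apply: eq_bigr => m _; rewrite -tensRZ mulr1.
Qed.

Lemma tensR_sum a (I : Type) (s : seq I) (F : I -> S) :
  tensR rG a (\sum_(i <- s) F i) = \sum_(i <- s) tensR rG a (F i).
Proof.
elim: s => [|i s IHs].
  rewrite !big_nil; have := tensR_balanced a 1 (SinvariantC rG 0).
  rewrite mpolyC0 mul0r => ->.
  by have := tensRZ 0 0 (1 : S); rewrite mul0r scale0r mulr0.
by rewrite !big_cons -IHs /tensR tensKDr; exact: raddfD.
Qed.

Lemma tensR_basis_span N (e : 'I_N -> S) (x : SRS rG) : invariant_basis rG e ->
  exists c : 'I_N -> S, x = \sum_i c i *: tensR rG 1 (e i).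
Proof.
case=> span _; have /choice[c cP] m : exists c : 'I_N -> S,
    tensR rG 1 'X_[m] = \sum_i c i *: tensR rG 1 (e i).
  have [r invr ->] := span 'X_[m]; exists r; rewrite tensR_sum.
  by apply: eq_bigr => i _; rewrite tensR_balanced // mul1r -{1}[r i]mulr1 tensRZ.
exists (fun i => \sum_(m <- msupp (repr x)) (repr x)@_m * c m i).
rewrite [LHS]SRS_sum; under [RHS]eq_bigr => i _ do rewrite scaler_suml.
rewrite exchange_big; apply: eq_bigr => m _ /=; rewrite cP scaler_sumr.
by apply: eq_bigr => i _; rewrite scalerA.
Qed.

Lemma phi_basis N (e c : 'I_N -> S) g :
  phi (\sum_i c i *: tensR rG 1 (e i)) g = \sum_i c i * Sact rG g (e i).
Proof.
by rewrite phi_sum; apply: eq_bigr => i _; rewrite phiZ phi_tensR mul1r.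
Qed.

(** In the left coordinates c_i with respect to the 1 (x) e_i, phi is the matrix (g(e_i)), whose
    kernel is trivial by [invariant_basis_nondegenerate]. *)
Lemma phi_injective : injective (@phi _ _ _ rG).
Proof.
have [N [e eP]] := exists_invariant_basis fP genG charK.
move=> x y eq_xy; apply/eqP; rewrite -subr_eq0.
have [c xyE] := tensR_basis_span (x - y) eP; rewrite xyE big1 // => i _.
rewrite (invariant_basis_nondegenerate (c := c) eP) ?scale0r // => g.
rewrite -phi_basis -xyE -[x]scale1r addrC -scaleN1r -[1 *: x]addr0.
by rewrite scale1r addr0 phi_linear MapsE eq_xy mulN1r addNr.
Qed.

Lemma finite_free_SRS : finite_free (SRS rG).
Proof.
have [N [e eP]] := exists_invariant_basis fP genG charK.
exists N, (fun i => tensR rG 1 (e i)) => x.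
have [c xE] := tensR_basis_span x eP.
exists (finfun c); split=> [|d xE'].
  by rewrite xE; apply: eq_bigr => i _; rewrite ffunE.
apply/ffunP => i; rewrite ffunE; apply/eqP; rewrite -subr_eq0; apply/eqP.
apply: (invariant_basis_nondegenerate (c := fun i => c i - d i) eP) => g.
have Ec := etrans (congr1 (fun y : SRS rG => phi y g) xE) (phi_basis e c g).
have Ed := etrans (congr1 (fun y : SRS rG => phi y g) xE') (phi_basis e d g).
have Es : \sum_j (c j - d j) * Sact rG g (e j) =
    \sum_j c j * Sact rG g (e j) - \sum_j d j * Sact rG g (e j).
  by rewrite -sumrB; apply: eq_bigr => j _; apply: mulrBl.
apply: (etrans Es); apply/eqP; rewrite subr_eq0; apply/eqP.
exact: etrans (esym Ec) Ed.
Qed.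

Lemma finite_free_Maps : finite_free (Maps K n gT).
Proof.
exists #|gT|, (fun i => [ffun g => (g == enum_val i)%:R]) => x.
have E (c : {ffun 'I_#|gT| -> S}) i :
    (\sum_j c j *: ([ffun g => (g == enum_val j)%:R] : Maps K n gT)) (enum_val i) = c i.
  rewrite sum_ffunE (bigD1 i) //= big1 => [|j ji]; rewrite ffunE [X in _ *: X]ffunE.
    by rewrite eqxx addr0; apply: mulr1.
  by rewrite (inj_eq enum_val_inj) eq_sym (negPf ji); apply: mulr0.
exists [ffun i => x (enum_val i)]; split=> [|c xE].
  apply/ffunP => g; rewrite -[g]enum_rankK E ffunE.
  by [].
by apply/ffunP => i; rewrite ffunE xE E.
Qed.

Lemma psi_det_linear : linear (psi_det rG nabla).
Proof.
move=> a s t; rewrite /psi_det -psi_linear; congr (psi _ _ _).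
apply/ffunP => g; rewrite MapsE !ffunE.
rewrite [X in _ *: X]/(a * (s g : S) + t g) scalerDr; congr (_ + _).
by rewrite -!mul_mpolyC; apply: mulrCA.
Qed.

Lemma phi_psi_det s : phi (psi_det rG nabla s) = jacobian f *: s.
Proof.
apply/ffunP => g; rewrite (phi_psi nablaP) // ffunE [RHS]ffunE.
transitivity ((\det (rG g) *: Sact rG g (jacobian f)) * s g).
  by rewrite -!mul_mpolyC mulrCA mulrA.
by rewrite (det_jacobian fP).
Qed.

Lemma psi_det_phi x : psi_det rG nabla (phi x) = jacobian f *: x.
Proof.
apply: phi_injective; rewrite phi_psi_det.
by apply/ffunP => g; rewrite phiZ ffunE.
Qed.

Lemma phi_psi_matrix_factorization :
  matrix_factorization (jacobian f) (@phi _ _ _ rG) (psi_det rG nabla).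
Proof.
split; first by split; [exact: finite_free_SRS | exact: finite_free_Maps].
split; [exact: phi_linear | exact: psi_det_linear | exact: phi_psi_det | exact: psi_det_phi].
Qed.

End MatrixFactorization.

(** * Identification of the cokernel with A/AeA *)

Section QuotientIsomorphism.
Variable B : comPzRingType.

Lemma submod_gen_sub (M : lmodType B) (X Y : M -> Prop) :
  (forall x, X x -> x \in submod_gen Y) ->
  forall x, x \in submod_gen X -> x \in submod_gen Y.
Proof.
move=> XY x /submod_genP[s [Xs ->]]; rewrite big_seq; apply: rpred_sum => c /Xs/XY.
exact: submod_genZ.
Qed.

Lemma quotmod_isomorphic (M M' : lmodType B) (X : M -> Prop) (Y : M' -> Prop)
    (u : M -> M') (v : M' -> M) : linear u -> cancel u v -> cancel v u ->
  (forall x, (x \in submod_gen X) = (u x \in submod_gen Y)) ->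
  isomorphic_modules (quotmod X) (quotmod Y).
Proof.
move=> lin_u uK vK XY.
have uB x y : u (x - y) = u x - u y.
  by rewrite addrC -scaleN1r lin_u scaleN1r addrC.
pose h (x : quotmod X) : quotmod Y := \pi_(quotmod Y) (u (repr x)).
have h_pi x : h (\pi_(quotmod X) x) = \pi_(quotmod Y) (u x).
  by apply/quotmod_eqP; rewrite -uB -XY; apply/quotmod_eqP; rewrite reprK.
pose h' (y : quotmod Y) : quotmod X := \pi_(quotmod X) (v (repr y)).
have h'_pi y : h' (\pi_(quotmod Y) y) = \pi_(quotmod X) (v y).
  by apply/quotmod_eqP; rewrite XY uB !vK; apply/quotmod_eqP; rewrite reprK.
exists h; last first.
  exists h' => x; rewrite -[x]reprK; first by rewrite h_pi h'_pi uK.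
  by rewrite h'_pi h_pi vK.
move=> a x y; rewrite -[x]reprK -[y]reprK -quotmod_pi_linear !h_pi lin_u.
exact: quotmod_pi_linear.
Qed.

End QuotientIsomorphism.

Section CokernelIsomorphism.
Variables (K : fieldType) (n : nat) (gT : finGroupType).
Variable rG : mx_representation K [set: gT] n.
Local Notation S := {mpoly K[n]}.
Hypothesis charK : #|gT|%:R != 0 :> K.
Local Notation A := (Defs.skew rG).

Lemma skew_idemE g : skew_idem rG g = (#|gT|%:R^-1 : K)%:MP.
Proof.
have sumE : (\sum_h delta rG h) g = 1.
  rewrite sum_ffunE (bigD1 g) //= big1 => [|h hg]; rewrite ffunE.
    by rewrite eqxx addr0.
  by rewrite eq_sym (negPf hg).
by rewrite ffunE sumE; apply: mulr1.
Qed.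

(** The right-hand side has the form s h(t) with s and t independent of h: this is phi of the pure
    tensor s (x) t. *)
Lemma skew_idem_mul (a b : A) (h : gT) : (a * skew_idem rG * b) h =
  ((#|gT|%:R^-1 : K)%:MP * (\sum_g (a g : S)) : S) *
    Sact rG h (\sum_l Sact rG l^-1%g (b l : S)).
Proof.
apply: etrans (skew_mulE _ _ _) _; rewrite Sact_sum mulr_sumr.
rewrite (reindex_inj (h := fun l => (h * l^-1)%g)) /=; last first.
  by move=> l l' /mulgI/invg_inj.
apply: eq_bigr => l _; rewrite invMg invgK mulgKV -SactM; congr (_ * _).
apply: etrans (skew_mulE _ _ _) _; rewrite mulr_sumr; apply: eq_bigr => g _.
by rewrite skew_idemE SactC mulrC.
Qed.

(** [Maps] and [skew] consist of the same functions from G to S with the same left S-action, so the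
    identity induces the isomorphism once the image of phi is seen to be AeA. *)
Lemma coker_phi_isomorphic :
  isomorphic_modules (coker (@phi _ _ _ rG)) (skew_bar rG).
Proof.
apply: (quotmod_isomorphic (u := fun x : Maps K n gT => (x : A))
  (v := fun x : A => (x : Maps K n gT))) => // x.
apply/idP/idP; apply: submod_gen_sub => {x} y; last first.
  case=> a [b ->]; apply: mem_submod_gen.
  exists (tensR rG ((#|gT|%:R^-1 : K)%:MP * (\sum_g (a g : S)))
    (\sum_l Sact rG l^-1%g (b l : S))).
  by apply/ffunP => h; rewrite phi_tensR skew_idem_mul.
case=> x <-; rewrite (SRS_sum x).
elim: (msupp _) => [|m s IHs].
  have -> : phi (\sum_(m <- [::]) (repr x)@_m *: tensR rG 1 'X_[m]) = 0.
    by apply/ffunP => g; rewrite phi_sum big_nil ffunE.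
  exact: rpred0.
rewrite big_cons phi_linear; apply: rpredD IHs; apply: submod_genZ.
(* The factor |G| cancels the normalization of the idempotent. *)
have -> : phi (tensR rG 1 'X_[m]) =
    (#|gT|%:R : K)%:MP *: ((1 : A) * skew_idem rG * ('X_[m] *: delta rG 1%g)).
  apply/ffunP => h; rewrite phi_tensR [RHS]ffunE skew_idem_mul.
  have -> : \sum_g ((1 : A) g : S) = 1.
    rewrite (bigD1 1%g) //= big1 => [|g /negPf g1]; rewrite ffunE ?eqxx ?addr0 //.
    by rewrite g1.
  have -> : \sum_l Sact rG l^-1%g (('X_[m] *: delta rG 1%g : A) l : S) = 'X_[m].
    rewrite (bigD1 1%g) //= big1 => [|l /negPf l1]; rewrite skewZ_deltaE.
      by rewrite eqxx mulr1 invg1 Sact1 addr0.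
    by rewrite l1 mulr0 rmorph0.
  apply: etrans (_ : ((#|gT|%:R : K)%:MP * (#|gT|%:R^-1 : K)%:MP) * Sact rG h 'X_[m] = _).
    by rewrite -mpolyCM mulfV.
  by rewrite mulr1; apply: esym (mulrA _ _ _).
by apply: submod_genZ; apply: mem_submod_gen; exists 1, ('X_[m] *: delta rG 1%g).
Qed.

End CokernelIsomorphism.

(** * Dimension and depth bounds *)

Section AlgebraicDependence.
Variables (K : fieldType) (n : nat).
Local Notation S := {mpoly K[n]}.

Lemma msize_mul_leq (p q : S) a b :
  (msize p <= a.+1)%N -> (msize q <= b.+1)%N -> (msize (p * q) <= (a + b).+1)%N.
Proof.
have [->|nz_p] := eqVneq p 0; first by rewrite mul0r mmeasure0.
have [->|nz_q] := eqVneq q 0; first by rewrite mulr0 mmeasure0.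
rewrite msizeM // (mpolySpred mdeg nz_p) (mpolySpred mdeg nz_q) !ltnS addSn /= addnS ltnS.
exact: leq_add.
Qed.

Lemma msize_exp_leq (p : S) a k : (msize p <= a.+1)%N -> (msize (p ^+ k) <= (k * a).+1)%N.
Proof.
move=> pa; elim: k => [|k IHk]; first by rewrite expr0 msize1.
by rewrite exprS mulSn; apply: msize_mul_leq.
Qed.

(* The monomials of degree < k in each of n+1 elements outnumber the monomials
   that can occur in them. *)
Lemma poly_alg_dependent (x : 'I_n -> S) (y : S) :
  exists2 P : {poly S}, P != 0 & (map_poly (msubst x) P).[y] = 0.
Proof.
pose d := maxn (msize y) (\max_i msize (x i)).
(* There are k^(n+1) products with exponents below k, each of size at most L. Since L <= D k, at
   most D^n k^n monomials can occur, and k was chosen larger than D^n. *)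
pose D := (n.+1 * d).+1; pose k := (D ^ n).+1; pose L := (n.+1 * d * k).+1.
pose A := ('I_k * {ffun 'I_n -> 'I_k})%type; pose F := {ffun 'I_n -> 'I_L}.
pose monA (a : A) : S := \prod_i x i ^+ (a.2 i : nat) * y ^+ (a.1 : nat).
pose expo l (b : {ffun 'I_n -> 'I_l}) : 'X_{1..n} := [multinom (b i : nat) | i < n].
have expo_inj l : injective (@expo l).
  move=> b b' /mnmP eq_b; apply/ffunP => i; apply: val_inj.
  by have := eq_b i; rewrite !mnmE.
have size_monA a : (msize (monA a) <= L)%N.
  have step (z : S) (i : 'I_k) : (msize z <= d)%N -> (msize (z ^+ i) <= (k * d).+1)%N.
    move=> zd; apply: leq_trans (msize_exp_leq i (leqW zd)) _.
    by rewrite ltnS leq_mul2r ltnW ?orbT.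
  have -> : L = (n * (k * d) + k * d).+1 by rewrite /L -mulSnr -mulnA [(d * k)%N]mulnC.
  apply: msize_mul_leq; last by apply: step; apply: leq_maxl.
  rewrite -[X in (X * _)%N](card_ord n) -sum_nat_const.
  apply: (big_ind2 (fun (q : S) e => (msize q <= e.+1)%N)) => [|q1 e1 q2 e2|i _].
  - by rewrite msize1.
  - exact: msize_mul_leq.
  - by apply: step; apply: leq_trans (leq_maxr _ _); apply: (leq_bigmax i).
pose C : 'M[K]_(#|{: A}|, #|{: F}|) := \matrix_(i, j) (monA (enum_val i))@_(expo _ (enum_val j)).
have lt_cards : (#|{: F}| < #|{: A}|)%N.
  rewrite card_prod !card_ffun !card_ord -expnS.
  have leL : (L <= D * k)%N by rewrite /L /D (mulSn (n.+1 * d)) -[X in (X <= _)%N]add1n leq_add2r.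
  have leLn : (L ^ n <= (D * k) ^ n)%N.
    by case: (posnP n) => [->|n_gt0]; rewrite ?expn0 // leq_exp2r.
  apply: leq_ltn_trans leLn _; rewrite expnMn expnS ltn_mul2r expn_gt0 /=.
  exact: ltnSn.
have : kermx C != 0.
  rewrite kermx_eq0 -row_leq_rank -ltnNge.
  by apply: leq_ltn_trans (rank_leq_col C) lt_cards.
case/rowV0Pn => u /sub_kermxP uC nz_u.
pose P : {poly S} :=
  \sum_(i < #|{: A}|) (u 0 i *: 'X_[expo _ (enum_val i).2]) *: 'X^((enum_val i).1).
have coefP l b : (P`_(l : 'I_k))@_(expo _ b) = u 0 (enum_rank ((l, b) : A)).
  rewrite coef_sum (raddf_sum (mcoeff _)) (bigD1 (enum_rank ((l, b) : A))) //=.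
  rewrite big1 => [|i ib]; rewrite coefZ coefXn.
    by rewrite enum_rankK eqxx mulr1 mcoeffZ mcoeffX eqxx mulr1 addr0.
  case: eqP => [lE|_]; last by rewrite mulr0 mcoeff0.
  rewrite mulr1 mcoeffZ mcoeffX (inj_eq (@expo_inj _)); case: eqP => [bE|_]; last by rewrite mulr0.
  case/eqP: ib; apply: (canRL (@enum_valK _)); move: lE bE.
  by case: (enum_val i) => l' b' /= /val_inj -> ->.
exists P.
  apply/eqP => P0; case/eqP: nz_u; apply/rowP => i; rewrite mxE.
  have := coefP (enum_val i).1 (enum_val i).2; rewrite -surjective_pairing enum_valK => <-.
  by rewrite P0 coef0 mcoeff0.
have PE : (map_poly (msubst x) P).[y] = \sum_i u 0 i *: monA (enum_val i).
  rewrite rmorph_sum horner_sum; apply: eq_bigr => i _ /=.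
  rewrite map_polyZ hornerZ map_polyXn hornerXn /= msubstZ -scalerAl; congr (_ *: (_ * _)).
  rewrite mpolyXE_id rmorph_prod; apply: eq_bigr => j _.
  by rewrite rmorphXn /= msubstX mnmE.
rewrite PE; apply/mpolyP => m; rewrite mcoeff0.
rewrite (raddf_sum (mcoeff m)) /=.
(* A monomial with some exponent at least L is too large to occur in any product; the others are the
   columns of [C]. *)
have [small|big] := boolP [forall i, (m i < L)%N]; last first.
  rewrite big1 // => i _; rewrite mcoeffZ memN_msupp_eq0 ?mulr0 //.
  apply: msize_mdeg_ge; apply: leq_trans (size_monA _) _.
  move: big; rewrite negb_forall => /existsP[j]; rewrite -leqNgt => le_Lm.
  apply: leq_trans le_Lm _.
  by rewrite mdegE (bigD1 j) //= leq_addr.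
pose b : F := [ffun i => Ordinal (forallP small i)].
have -> : m = expo _ b by apply/mnmP => i; rewrite mnmE ffunE.
have /rowP/(_ (enum_rank b)) := uC; rewrite !mxE => {2}<-.
by apply: eq_bigr => i _; rewrite mcoeffZ mxE enum_rankK.
Qed.

(** If the relation has a nonzero constant term in y, that term is a polynomial in x divisible by y;
    otherwise y cancels and the relation gets shorter. *)
Lemma poly_alg_dependent_mod (x : 'I_n -> S) (y : S) : y != 0 ->
  exists2 q : S, q != 0 & exists w, msubst x q = w * y.
Proof.
move=> nz_y; have [P nz_P] := poly_alg_dependent x y; elim/poly_ind: P nz_P => [|P c IHP].
  by rewrite eqxx.
rewrite rmorphD rmorphM /= map_polyX map_polyC /= hornerMXaddC => nz_P eq0.
have [c0|nz_c] := eqVneq c 0; last first.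
  exists c => //; exists (- (map_poly (msubst x) P).[y]).
  by rewrite mulNr; apply/eqP; rewrite -addr_eq0 addrC eq0.
apply: IHP; first by apply: contra_neq nz_P => ->; rewrite c0 mul0r addr0.
apply/eqP; rewrite -(mulIr_eq0 _ (mulIf nz_y)); move: eq0.
by rewrite c0 rmorph0 addr0 => ->.
Qed.

End AlgebraicDependence.

Section RegularTower.
Variable B : comPzRingType.

(** Exponents form a list, read as zero past its end, so that the first element can be peeled off
    recursively. *)
Fixpoint monomial_at (x : seq B) (a : seq nat) : B :=
  if x is z :: x' then z ^+ head 0%N a * monomial_at x' (behead a) else 1.

Lemma monomial_atE k (x : seq B) (a : seq nat) : size x = k ->
  monomial_at x a = \prod_(i < k) x`_i ^+ nth 0%N a i.
Proof.
elim: x k a => [|z x IHx] [|k] a //= => [_|[/IHx xE]]; first by rewrite big_ord0.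
by rewrite big_ord_recl xE nth0; congr (_ * _); apply: eq_bigr => i _; rewrite nth_behead.
Qed.

(* Take the lowest exponent m of x_0 in the relation: regularity cancels x_0^m, and
   the terms still divisible by x_0 fall into T 1, leaving a shorter relation. *)
Lemma regular_tower (M : lmodType B) (x : seq B) (T : nat -> M -> Prop)
    (s : seq (B * seq nat)) (y : M) :
  (forall i a u v, T i u -> T i v -> T i (a *: u + v)) ->
  (forall i, (i < size x)%N -> [/\ forall z, T i (x`_i *: z) -> T i z,
     forall z, T i z -> T i.+1 z & forall z, T i.+1 (x`_i *: z)]) ->
  uniq [seq c.2 | c <- s] -> s != [::] -> (forall c, c \in s -> size c.2 = size x) ->
  (forall c, c \in s -> forall z, T (size x) (c.1 *: z) -> T (size x) z) ->
  T 0 ((\sum_(c <- s) c.1 * monomial_at x c.2) *: y) -> T (size x) y.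
Proof.
elim: x T s => [|z x IHx] T s Tlin Tx uniq_s nz_s size_s reg_s.
  (* With no elements left all exponent lists are empty, so distinctness leaves a single term, whose
     coefficient cancels by [reg_s]. *)
  case: s => [|c [|c' s]] // in uniq_s nz_s size_s reg_s *.
    by rewrite big_seq1 mulr1; apply: reg_s; rewrite mem_head.
  have /size0nil c0 := size_s c (mem_head _ _).
  have /size0nil c'0 : size c'.2 = 0 by apply: size_s; rewrite !inE eqxx orbT.
  by move: uniq_s; rewrite /= inE c0 c'0 eqxx.
have [m [c cs cm] min_m] : exists2 m, (exists2 c, c \in s & head 0%N c.2 = m) &
    forall c, c \in s -> (m <= head 0%N c.2)%N.
  pose has_head m := has (fun c => head 0%N c.2 == m) s.
  have ex_head : exists m, has_head m.
    case: s nz_s @has_head {uniq_s size_s reg_s} => // c s _.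
    by exists (head 0%N c.2); apply/hasP; exists c; rewrite ?mem_head.
  case: (ex_minnP ex_head) => m /hasP[c cs /eqP cm] min_m; exists m; first by exists c.
  by move=> d ds; apply: min_m; apply/hasP; exists d.
pose s' := [seq (c.1, behead c.2) | c <- s & head 0%N c.2 == m].
have [Tz T01 Tz1] : [/\ forall u, T 0 (z *: u) -> T 0 u,
     forall u, T 0 u -> T 1 u & forall u, T 1 (z *: u)] by apply: (Tx 0%N).
have Tzk k u : T 0 (z ^+ k *: u) -> T 0 u.
  by elim: k => [|k IHk]; rewrite ?expr0 ?scale1r // exprS -scalerA => /Tz.
have s'P c' : c' \in s' -> exists2 d, d \in s & head 0%N d.2 = m /\ c' = (d.1, behead d.2).
  by case/mapP => d; rewrite mem_filter => /andP[/eqP dm ds] ->; exists d.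
have [w sumE] : exists w, \sum_(c <- s) c.1 * monomial_at (z :: x) c.2 =
    z ^+ m * (\sum_(c <- s') c.1 * monomial_at x c.2 + z * w).
  exists (\sum_(c <- s | head 0%N c.2 != m)
    c.1 * z ^+ (head 0%N c.2 - m.+1) * monomial_at x (behead c.2)).
  rewrite (bigID (fun c => head 0%N c.2 == m)) /= mulrDr; congr (_ + _).
    rewrite big_map big_filter mulr_sumr; apply: eq_bigr => d /eqP ->.
    by rewrite mulrCA.
  rewrite mulrA -exprSr mulr_sumr big_seq_cond [RHS]big_seq_cond.
  apply: eq_bigr => d /andP[ds dm]; have lt_m : (m < head 0%N d.2)%N.
    by rewrite ltn_neqAle eq_sym dm min_m.
  by rewrite -{1}(subnKC lt_m) exprD !mulrA [_ * d.1]mulrC.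
rewrite sumE -scalerA => /Tzk/T01; rewrite scalerDl => T1.
apply: (IHx (fun i => T i.+1) s').
- by move=> i; apply: (Tlin i.+1).
- by move=> i lt_i; apply: (Tx i.+1).
(* Putting m back in front recovers the original exponent lists, so the shortened ones remain
   distinct. *)
- apply: (@map_uniq _ _ (cons m)); rewrite -!map_comp.
  rewrite (_ : map _ _ = [seq c.2 | c <- s & head 0%N c.2 == m]).
    by apply: subseq_uniq uniq_s; apply: map_subseq; apply: filter_subseq.
  apply/eq_in_map => d; rewrite mem_filter => /andP[/eqP dm ds] /=.
  by have := size_s d ds; case: d.2 dm => //= ? ? ->.
- have : (c.1, behead c.2) \in s'.
    by apply: (map_f (fun c => (c.1, behead c.2))); rewrite mem_filter cm eqxx.
  by apply: contraTneq => ->.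
- by move=> _ /s'P[d ds [_ ->]] /=; rewrite size_behead size_s.
- move=> _ /s'P[d ds [_ ->]] /=; exact: (reg_s d).
- rewrite -[_ *: y](addrK ((z * w) *: y)) addrC -scaleN1r.
  apply: (Tlin 1%N) => //; rewrite -scalerA; exact: Tz1.
Qed.

End RegularTower.

Section DimensionBound.
Variables (K : fieldType) (n : nat).
Local Notation S := {mpoly K[n]}.

(** Common source of [prime_chain_bound] and [annihilated_coker_depth_bound]: n elements are
    algebraically dependent modulo J with coefficients in K. *)
Lemma regular_tower_size_bound (M : lmodType S) (J : S) (x : seq S)
    (T : nat -> M -> Prop) (y : M) : J != 0 -> size x = n ->
  (forall i a u v, T i u -> T i v -> T i (a *: u + v)) ->
  (forall i, (i < size x)%N -> [/\ forall z, T i (x`_i *: z) -> T i z,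
     forall z, T i z -> T i.+1 z & forall z, T i.+1 (x`_i *: z)]) ->
  (forall z, T 0 (J *: z)) -> T n y.
Proof.
move=> nz_J size_x Tlin Tx TJ.
have [q nz_q [w qE]] := poly_alg_dependent_mod (fun i : 'I_n => x`_i) nz_J.
pose s := [seq ((q@_m)%:MP : S, m : seq nat) | m : 'X_{1..n} <- msupp q].
rewrite -size_x; apply: (regular_tower (s := s) Tlin Tx).
- rewrite -map_comp map_inj_uniq ?msupp_uniq // => m m' /= eq_m.
  by apply/val_inj/val_inj.
- by rewrite -size_eq0 size_map size_eq0 msupp_eq0.
- by move=> _ /mapP[m _ ->] /=; rewrite size_tuple.
- move=> _ /mapP[m mq ->] z /= Tz; rewrite -[z]scale1r -(mpolyC1 n K).
  (* [Tlin] only offers combinations a u + v, so 1 is split into two multiples of the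
     coefficient. *)
  have -> : (1 : K)%:MP = ((q@_m)^-1 - 1)%:MP * (q@_m)%:MP + (q@_m)%:MP :> S.
    by rewrite -mpolyCM -mpolyCD mulrBl mul1r subrK mulVf // -mcoeff_msupp.
  by rewrite scalerDl -scalerA; apply: (Tlin).
- have -> : \sum_(c <- s) c.1 * monomial_at x c.2 = w * J; last first.
    by rewrite mulrC -scalerA.
  rewrite -qE /s big_map /msubst comp_mpolyEX; apply: eq_bigr => m _ /=.
  rewrite mul_mpolyC comp_mpolyX; congr (_ *: _).
  rewrite (monomial_atE _ size_x); apply: eq_bigr => i _.
  by rewrite tnth_mktuple -tnth_nth.
Qed.

Lemma prime_chain_bound (J : S) (p : nat -> S -> Prop) : J != 0 ->
  (forall i, (i <= n)%N -> prime_ideal (p i)) ->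
  (forall i, (i < n)%N -> (forall u, p i u -> p i.+1 u) /\
     exists2 u, p i.+1 u & ~ p i u) ->
  ~ p 0%N J.
Proof.
move=> nz_J primep chain p0J.
(* Closure under combinations is demanded at every index, so the chain is continued constantly
   beyond n. *)
pose p' i := p (minn i n).
have p'E i u : p' i u = p (minn i n) u by [].
have primep' i : prime_ideal (p' i) by apply: primep; apply: geq_minr.
have /choice[x xP] i : exists u, (i < n)%N -> p i.+1 u /\ ~ p i u.
  case: (ltnP i n) => [/chain[_ [u pu npu]]|_]; last by exists 0.
  by exists u.
have [_ + _] := primep _ (leqnn n); apply.
suff : p' n 1 by rewrite p'E minnn.
apply: (@regular_tower_size_bound (S^o : lmodType S) J (mkseq x n) p' 1 nz_J).
- by rewrite size_mkseq.
- by move=> i a u v; case: (primep' i) => -[_ lin] _ _; apply: lin.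
- move=> i; rewrite size_mkseq => lt_in; rewrite nth_mkseq //.
  have [px npx] := xP i lt_in; have [sub _] := chain i lt_in.
  have mi : minn i n = i by apply/minn_idPl/ltnW.
  have mi1 : minn i.+1 n = i.+1 by apply/minn_idPl.
  split=> z; rewrite !p'E ?mi ?mi1.
  + by have [_ _ pr] := primep _ (ltnW lt_in); case/pr.
  + exact: sub.
  + have [[p0 lin] _ _] := primep _ lt_in; rewrite [_ *: _]mulrC -[_ * _]addr0.
    exact: lin.
- move=> z; rewrite p'E min0n; have [[p0 lin] _ _] := primep _ (leq0n n).
  by rewrite [_ *: _]mulrC -[_ * _]addr0; apply: lin.
Qed.

End DimensionBound.

(** * Regular sequences on cokernels *)

Section IdealSmul.
Variable B : comPzRingType.
Implicit Types (xs : seq B) (M N F : lmodType B).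

Lemma linear_at0 M N (u : M -> N) : linear u -> u 0 = 0.
Proof. by move=> lin_u; have := lin_u (-1) 0 0; rewrite scaler0 addr0 scaleN1r addNr. Qed.

Lemma mem_ideal_smul M xs x (z : M) : x \in xs -> x *: z \in ideal_smul (M := M) xs.
Proof. by move=> xs_x; apply: mem_submod_gen; exists x => //; exists z. Qed.

Lemma ideal_smulS M xs xs' (y : M) : {subset xs <= xs'} ->
  y \in ideal_smul (M := M) xs -> y \in ideal_smul (M := M) xs'.
Proof.
move=> sub; apply: submod_gen_sub => _ [x xs_x [z ->]].
by apply: mem_ideal_smul; apply: sub.
Qed.

Lemma ideal_smul_linear M N (u : M -> N) xs y : linear u ->
  y \in ideal_smul (M := M) xs -> u y \in ideal_smul (M := N) xs.
Proof.
move=> lin_u /submod_genP[s [Xs ->]].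
have u0 := linear_at0 lin_u.
elim: s Xs => [|c s IHs] Xs; first by rewrite big_nil u0 rpred0.
rewrite big_cons lin_u rpredD //; last by apply: IHs => d ds; apply: Xs; rewrite inE ds orbT.
have [x xs_x [z ->]] := Xs c (mem_head _ _); rewrite rpredZ //.
rewrite -[x *: z]addr0 lin_u u0 addr0; exact: mem_ideal_smul.
Qed.

Lemma ideal_smul_rcons M xs x (y : M) : y \in ideal_smul (M := M) (rcons xs x) ->
  exists z, y - x *: z \in ideal_smul (M := M) xs.
Proof.
case/submod_genP => s [Xs ->].
elim: s Xs => [|c s IHs] Xs; first by exists 0; rewrite big_nil scaler0 subrr rpred0.
have [z Iz] : exists z, \sum_(c <- s) c.1 *: c.2 - x *: z \in ideal_smul (M := M) xs.
  by apply: IHs => d ds; apply: Xs; rewrite inE ds orbT.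
have [x' xs_x' [z' c2E]] := Xs c (mem_head _ _); rewrite big_cons c2E.
move: xs_x'; rewrite mem_rcons inE => /orP[/eqP ->|xs_x'].
  exists (c.1 *: z' + z); rewrite scalerDr !scalerA [x * _]mulrC.
  by rewrite opprD addrACA subrr add0r.
exists z; rewrite -addrA rpredD // rpredZ //; exact: mem_ideal_smul.
Qed.

(** Coordinates are linear, so they map (xs) F into (xs), and the question is decided in each
    coordinate. *)
Lemma free_ideal_smul_regular F xs a : finite_free F ->
  (forall b : B^o, a *: b \in ideal_smul (M := B^o) xs -> b \in ideal_smul (M := B^o) xs) ->
  forall y : F, a *: y \in ideal_smul (M := F) xs -> y \in ideal_smul (M := F) xs.
Proof.
case=> r [b freeF] reg y; have /choice[c cP] z : exists c : {ffun 'I_r -> B},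
    z = \sum_i c i *: b i by have [c [zE _]] := freeF z; exists c.
have uniqc z (d d' : {ffun 'I_r -> B}) :
    z = \sum_i d i *: b i -> z = \sum_i d' i *: b i -> d = d'.
  by have [e [_ eU]] := freeF z => /eU <- /eU <-.
have coord_lin i : linear (fun z => c z i : B^o).
  move=> k u v; have -> : c (k *: u + v) = [ffun i => k * c u i + c v i].
    apply: (uniqc (k *: u + v)); first exact: cP.
    under eq_bigr => j _ do rewrite ffunE scalerDl -scalerA.
    by rewrite big_split -scaler_sumr -!cP.
  by rewrite ffunE.
move=> Iay; rewrite (cP y); apply: rpred_sum => i _.
apply: (ideal_smul_linear (u := fun k : B^o => (k : B) *: b i)).
  by move=> k u v; rewrite scalerDl scalerA.
apply: reg; have := ideal_smul_linear (coord_lin i) Iay.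
have c0 : c 0 = [ffun=> 0].
  apply: (uniqc 0); first exact: cP.
  by rewrite big1 // => j _; rewrite ffunE scale0r.
by have := coord_lin i a y 0; rewrite addr0 c0 ffunE addr0 => ->.
Qed.

Lemma ideal_smul_quotmod N (X : N -> Prop) xs (y : quotmod X) :
  y \in ideal_smul (M := quotmod X) xs ->
  exists2 z, z \in ideal_smul (M := N) xs & \pi_(quotmod X) z = y.
Proof.
case/submod_genP => s [Xs ->].
elim: s Xs => [|c s IHs] Xs; first by exists 0; rewrite ?rpred0 // big_nil; exact: raddf0.
have [|z Iz zE] := IHs; first by move=> d ds; apply: Xs; rewrite inE ds orbT.
have [x xs_x [z' c2E]] := Xs c (mem_head _ _); rewrite big_cons c2E -zE.
exists (c.1 *: (x *: repr z') + z).
  by rewrite rpredD // rpredZ //; apply: mem_ideal_smul.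
by rewrite quotmod_pi_linear.
Qed.

Section Cokernel.
Variables (F N : lmodType B) (u : F -> N) (v : N -> F) (w : B).
Hypothesis uv : matrix_factorization w u v.

Lemma coker_eqP (x y : N) :
  \pi_(coker u) x = \pi_(coker u) y -> exists z, x - y = u z.
Proof.
case: uv => _ [lin_u _ _ _].
have u0 := linear_at0 lin_u.
move/quotmod_eqP/submod_genP => [s [Xs ->]].
elim: s Xs => [|c s IHs] Xs; first by exists 0; rewrite big_nil.
have [|z zE] := IHs; first by move=> d ds; apply: Xs; rewrite inE ds orbT.
have [z' z'E] := Xs c (mem_head _ _).
by exists (c.1 *: z' + z); rewrite big_cons zE -z'E lin_u.
Qed.

Lemma coker_annihilated (x : coker u) : w *: x = 0.
Proof.
case: uv => _ [lin_u _ uvE _]; rewrite -[x]reprK.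
have -> : w *: (\pi_(coker u) (repr x) : coker u) = \pi_(coker u) (w *: repr x).
  exact: quotmod_scale_pi.
apply: etrans (_ : \pi_(coker u) 0 = 0); last exact: raddf0.
apply/quotmod_eqP; rewrite subr0 -uvE; apply: mem_submod_gen.
by exists (v (repr x)).
Qed.

(** Lift y to N: x y = z + u t with z in (xs) N. Applying v puts w t in (xs, x) F, so t = x t'
    modulo (xs) F because w is regular modulo (xs, x). Then x (y - u t') lies in (xs) N, hence so
    does y - u t', which represents the same class as y. *)
Lemma coker_regular xs x :
  (forall b : B^o, w *: b \in ideal_smul (M := B^o) (rcons xs x) ->
     b \in ideal_smul (M := B^o) (rcons xs x)) ->
  (forall b : B^o, x *: b \in ideal_smul (M := B^o) xs ->
     b \in ideal_smul (M := B^o) xs) ->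
  forall y : coker u, x *: y \in ideal_smul (M := coker u) xs ->
    y \in ideal_smul (M := coker u) xs.
Proof.
case: (uv) => -[freeF freeN] [lin_u lin_v _ vuE] regw regx y Ixy.
have [z Iz zE] := ideal_smul_quotmod Ixy.
have [t tE] : exists t, x *: repr y - z = u t.
  by apply: coker_eqP; rewrite zE.
have sub : {subset xs <= rcons xs x} by move=> b bx; rewrite mem_rcons inE bx orbT.
have Iwt : w *: t \in ideal_smul (M := F) (rcons xs x).
  rewrite -vuE -tE addrC -scaleN1r lin_v rpredD ?rpredZ //.
    by apply: ideal_smulS sub _; apply: ideal_smul_linear Iz.
  rewrite -[x *: repr y]addr0 lin_v (linear_at0 lin_v) addr0.
  by apply: mem_ideal_smul; rewrite mem_rcons mem_head.
have [t' It'] := ideal_smul_rcons (free_ideal_smul_regular freeF regw Iwt).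
have Iy : repr y - u t' \in ideal_smul (M := N) xs.
  apply: free_ideal_smul_regular freeN regx _ _.
  have -> : x *: (repr y - u t') = u (t - x *: t') + z.
    have -> : t - x *: t' = - x *: t' + t by rewrite scaleNr addrC.
    by rewrite lin_u -tE scaleNr -addrA subrK addrC scalerBr.
  by rewrite rpredD //; apply: ideal_smul_linear It'.
rewrite -[y]reprK; have -> : \pi_(coker u) (repr y) = \pi_(coker u) (repr y - u t').
  apply/quotmod_eqP; rewrite opprB addrCA subrr addr0; apply: mem_submod_gen.
  by exists t'.
exact: ideal_smul_linear (@quotmod_pi_linear _ _ _) Iy.
Qed.

End Cokernel.
End IdealSmul.

(** * Linear sections of a hypersurface *)

Section KernelOfSubstitution.
Variables (K : fieldType) (n : nat).
Local Notation S := {mpoly K[n]}.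

Lemma prime_ideal_ker (B1 : comNzRingType) (B2 : idomainType)
    (h : {rmorphism B1 -> B2}) : prime_ideal (fun u => h u = 0).
Proof.
split; first split; first exact: rmorph0.
- by move=> a u v hu hv; rewrite rmorphD rmorphM hu hv mulr0 addr0.
- by rewrite rmorph1 => /eqP; rewrite oner_eq0.
- by move=> u v /eqP; rewrite rmorphM mulf_eq0 => /orP[] /eqP; [left | right].
Qed.

(** Every p is congruent to its substitution modulo (xs), so p lies in (xs) as soon as the
    substitution kills it. *)
Lemma msubst_ker (xs : seq S) (y : 'I_n -> S) :
  (forall x, x \in xs -> msubst y x = 0) ->
  (forall j, 'X_j - y j \in ideal_smul (M := S^o) xs) ->
  forall p : S^o, (p \in ideal_smul (M := S^o) xs) = (msubst y p == 0).
Proof.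
move=> y0 yxs p; apply/idP/eqP => [/submod_genP[s [Xs ->]]|yp0].
  rewrite rmorph_sum big_seq big1 // => c /Xs[x xs_x [z ->]].
  rewrite (_ : c.1 *: (x *: z) = c.1 * (x * z)) // !rmorphM /=.
  by rewrite (y0 _ xs_x) mul0r mulr0.
rewrite -[p]subr0 -yp0.
apply: (mpoly_congr (h1 := idfun) (h2 := msubst y)
  (I := fun u : S => (u : S^o) \in ideal_smul (M := S^o) xs)) => [|a|j] /=.
- by split=> [|a u v Iu Iv]; [apply: rpred0 | apply: rpredD => //; apply: submod_genZ].
- by rewrite msubstC.
- by rewrite msubstX; apply: yxs.
Qed.

(** Restriction to the hyperplane a = 0, solved for the coordinate j1. *)
Definition hyperplane_subst (a : 'rV[K]_n) j1 (j : 'I_n) : S :=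
  if j == j1 then 'X_j - (a 0 j1)^-1 *: linear_form a else 'X_j.

Lemma hyperplane_subst_form (a : 'rV[K]_n) j1 : a 0 j1 != 0 ->
  msubst (hyperplane_subst a j1) (linear_form a) = 0.
Proof.
move=> nz_a; rewrite {1}/linear_form rmorph_sum (bigD1 j1) //= msubstZ msubstX.
rewrite /hyperplane_subst eqxx scalerBr scalerA mulfV // scale1r.
apply/eqP; rewrite addrAC subr_eq0 /linear_form [X in _ == X](bigD1 j1) //=.
apply/eqP; congr (_ + _); apply: eq_bigr => k /negPf kj.
by rewrite msubstZ msubstX /hyperplane_subst kj.
Qed.

Lemma hyperplane_subst_ker (a : 'rV[K]_n) j1 (p : S) : a 0 j1 != 0 ->
  msubst (hyperplane_subst a j1) p = 0 -> exists q, p = linear_form a * q.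
Proof.
move=> nz_a /eqP; rewrite -(msubst_ker (xs := [:: linear_form a])).
- move=> /(@ideal_smul_rcons _ S^o [::])[q /submod_genP[[|c s] [Xs pE]]]; last first.
    by have [] := Xs c (mem_head _ _).
  by exists q; apply/eqP; rewrite -subr_eq0; apply/eqP; rewrite big_nil in pE.
- by move=> x; rewrite inE => /eqP ->; apply: hyperplane_subst_form.
- move=> j; rewrite /hyperplane_subst; case: eqP => _; last by rewrite subrr; exact: rpred0.
  rewrite opprB addrCA subrr addr0 -mul_mpolyC mulrC.
  by apply: (@mem_ideal_smul _ S^o); rewrite mem_head.
Qed.

(** A linear form is prime, so the first one divides w or J. In the first case cancel it from w. In
    the second it is the desired form if it vanishes at v; if not, it is cancelled from J, and the
    quotient still vanishes at v. *)
Lemma linear_factor_at (J w : S) (s : seq 'rV[K]_n) (v : 'I_n -> K) :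
  (forall a, a \in s -> a != 0) -> \prod_(a <- s) linear_form a = w * J ->
  J.@[v] = 0 -> exists (a : 'rV[K]_n) j1, [/\ a 0 j1 != 0, (linear_form a).@[v] = 0 &
    msubst (hyperplane_subst a j1) J = 0].
Proof.
elim: s J w => [|a s IHs] J w s0 sE Jv.
  move/(congr1 (meval v)): sE; rewrite big_nil mevalM Jv mulr0 meval1.
  by move/eqP; rewrite oner_eq0.
have [j1 nz_a] : exists j1, a 0 j1 != 0.
  have /rV0Pn[j aj] : a != 0 by apply: s0; rewrite mem_head.
  by exists j.
have nz_la : linear_form a != 0 by rewrite linear_form_neq0 s0 ?mem_head.
have s0' b : b \in s -> b != 0 by move=> bs; apply: s0; rewrite inE bs orbT.
rewrite big_cons in sE.
have /eqP : msubst (hyperplane_subst a j1) w * msubst (hyperplane_subst a j1) J = 0.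
  by rewrite -rmorphM -sE rmorphM /= hyperplane_subst_form // mul0r.
rewrite mulf_eq0 => /orP[] /eqP.
  case/(hyperplane_subst_ker nz_a) => w' wE; apply: (IHs J w') => //.
  by apply: (mulfI nz_la); rewrite sE wE mulrA.
move=> J0; have [av|nz_av] := eqVneq (linear_form a).@[v] 0; first by exists a, j1.
have [J' JE] := hyperplane_subst_ker nz_a J0.
have [||b [j2 [nz_b bv J'0]]] := IHs J' w s0'.
- by apply: (mulfI nz_la); rewrite sE JE mulrCA.
- by apply: (mulfI nz_av); rewrite -mevalM -JE Jv mulr0.
exists b, j2; split; [exact: nz_b | exact: bv |].
by rewrite JE rmorphM /= J'0 mulr0.
Qed.

End KernelOfSubstitution.

Section LinearSections.
Variables (K : fieldType) (n : nat).
Local Notation S := {mpoly K[n]}.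

(** p_i is the ideal of the part of the hyperplane where the first i coordinates other than j1 agree
    with those of v. It is the kernel of a substitution into a domain. *)
Lemma hyperplane_prime_chain (J : S) (a : 'rV[K]_n) j1 (v : 'I_n -> K) :
  a 0 j1 != 0 -> (linear_form a).@[v] = 0 -> msubst (hyperplane_subst a j1) J = 0 ->
  exists p : nat -> S -> Prop, [/\ forall i, prime_ideal (p i),
    forall i, (i < n.-1)%N -> (forall u, p i u -> p i.+1 u) /\
      exists2 u, p i.+1 u & ~ p i u,
    p 0%N J & forall u, p n.-1 u -> u.@[v] = 0].
Proof.
case: n J a j1 v => [|n'] J a j1 v; first by case: j1.
move=> nz_a av J0.
pose y i (k : 'I_n') : {mpoly K[n'.+1]} :=
  if (k < i)%N then (v (lift j1 k))%:MP else 'X_(lift j1 k).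
pose t i (j : 'I_n'.+1) : {mpoly K[n'.+1]} := if unlift j1 j is Some k then y i k
  else - (a 0 j1)^-1 *: \sum_k a 0 (lift j1 k) *: y i k.
have t_lift i k : t i (lift j1 k) = y i k by rewrite /t liftK.
have t_j1 i : t i j1 = - (a 0 j1)^-1 *: \sum_k a 0 (lift j1 k) *: y i k.
  by rewrite /t unlift_none.
exists (fun i u => msubst (t i) u = 0); split=> [i|i lt_in||u].
- exact: prime_ideal_ker.
(* Fixing i + 1 coordinates absorbs having fixed i of them; this gives the inclusion. It is strict
   because of the newly fixed coordinate minus its value at v. *)
- have tt u : msubst (t i.+1) (msubst (t i) u) = msubst (t i.+1) u.
    apply: msubst_comp => j; case: (unliftP j1 j) => [k|] ->.
      rewrite t_lift /y; case: ifP => [lt_ki|_]; last by rewrite msubstX.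
      by rewrite msubstC t_lift /y ltnS ltnW.
    rewrite !t_j1 msubstZ rmorph_sum; congr (_ *: _); apply: eq_bigr => k _ /=.
    rewrite msubstZ {1}/y; case: ifP => [lt_ki|_]; last by rewrite msubstX t_lift.
    by rewrite msubstC /y ltnS ltnW.
  split=> [u u0|]; first by rewrite -tt u0 rmorph0.
  pose k := Ordinal lt_in; exists ('X_(lift j1 k) - (v (lift j1 k))%:MP).
    by rewrite rmorphB /= msubstX msubstC t_lift /y /= ltnSn subrr.
  rewrite rmorphB /= msubstX msubstC t_lift /y /= ltnn => /(congr1 (mcoeff U_(lift j1 k))).
  rewrite mcoeffB mcoeffXU eqxx mcoeffC mnm1_eq0 mulr0 subr0 mcoeff0.
  by move/eqP; rewrite oner_eq0.
- rewrite -[RHS]J0; apply: (mpoly_rmorph_ext (h1 := msubst (t 0))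
    (h2 := msubst (hyperplane_subst a j1))) => [c|j] /=; first by rewrite !msubstC.
  rewrite !msubstX /hyperplane_subst; case: (unliftP j1 j) => [k|] ->.
    by rewrite t_lift /y ltn0 eq_sym (negPf (neq_lift _ _)).
  rewrite eqxx t_j1 /linear_form (bigD1_ord j1) //= scalerDr scalerA mulVf // scale1r.
  by rewrite opprD addrA subrr add0r scaleNr.
- move/(congr1 (meval v)); rewrite meval0 msubst_meval => <-.
  apply: meval_eq => j; case: (unliftP j1 j) => [k|] ->.
    by rewrite t_lift /y ltn_ord mevalC.
  rewrite t_j1 mevalZ (raddf_sum (meval v)) /=.
  move: av; rewrite /linear_form (raddf_sum (meval v)) (bigD1_ord j1) //= mevalZ mevalXU.
  move/eqP; rewrite addr_eq0 => /eqP avE.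
  apply: (mulfI nz_a); rewrite avE mulrA mulrN mulfV // mulN1r; congr (- _).
  by apply: eq_bigr => k _; rewrite !mevalZ mevalXU /y ltn_ord mevalC.
Qed.

(** The forms cut out the line through v and z. Modulo the first i of them S embeds in a domain,
    where J is nonzero as its value at z survives, and the next form is nonzero as it keeps its own
    variable. *)
Lemma line_regular_sequence (J : S) (v z : 'I_n -> K) :
  J.@[v] = 0 -> J.@[z] != 0 ->
  exists l : seq S, [/\ size l = n.-1, forall x, x \in l -> x.@[v] = 0,
    forall i (b : S^o), J *: b \in ideal_smul (M := S^o) (take i l) ->
      b \in ideal_smul (M := S^o) (take i l) &
    forall i (b : S^o), (i < n.-1)%N -> l`_i *: b \in ideal_smul (M := S^o) (take i l) ->
      b \in ideal_smul (M := S^o) (take i l)].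
Proof.
case: n J v z => [|n'] J v z Jv Jz.
  by case/eqP: Jz; rewrite -Jv; apply: meval_eq => -[].
(* Coordinate j0 parametrizes the line; each other coordinate yields one form. *)
have [j0 nz_w] : exists j0, z j0 != v j0.
  apply/existsP; rewrite -[X in is_true X]negbK negb_exists; apply/negP => /forallP eq_zv.
  by case/eqP: Jz; rewrite -Jv; apply: meval_eq => j; apply/eqP; have := eq_zv j; rewrite negbK.
rewrite -subr_eq0 in nz_w.
pose slope j := (z j - v j) / (z j0 - v j0).
pose lf (k : 'I_n') : {mpoly K[n'.+1]} := 'X_(lift j0 k) - (v (lift j0 k))%:MP -
  (slope (lift j0 k))%:MP * ('X_j0 - (v j0)%:MP).
pose l := [seq lf k | k <- enum 'I_n'].
have size_l : size l = n' by rewrite size_map size_enum_ord.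
have nth_l (k : 'I_n') : l`_k = lf k.
  by rewrite (nth_map k) ?size_enum_ord // nth_ord_enum.
have mem_takeP i x : x \in take i l -> exists2 k : 'I_n', (k < i)%N & x = lf k.
  move=> /(nthP 0)[m]; rewrite size_take_min => lt_m <-.
  have lt_mi : (m < i)%N by apply: leq_trans lt_m (geq_minl _ _).
  have lt_mn : (m < n')%N by rewrite -size_l; apply: leq_trans lt_m (geq_minr _ _).
  by exists (Ordinal lt_mn); rewrite ?nth_take // (nth_l (Ordinal lt_mn)).
have mem_take i (k : 'I_n') : (k < i)%N -> lf k \in take i l.
  move=> lt_ki; rewrite -nth_l -(nth_take _ lt_ki); apply: mem_nth.
  by rewrite size_take_min leq_min lt_ki size_l ltn_ord.
pose r i (j : 'I_n'.+1) : {mpoly K[n'.+1]} := if unlift j0 j is Some k then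
  (if (k < i)%N then 'X_j - lf k else 'X_j) else 'X_j.
have r_lift i k : r i (lift j0 k) = if (k < i)%N then 'X_(lift j0 k) - lf k else 'X_(lift j0 k).
  by rewrite /r liftK.
have r_j0 i : r i j0 = 'X_j0 by rewrite /r unlift_none.
have r_lf i k : msubst (r i) (lf k) = if (k < i)%N then 0 else lf k.
  rewrite {1}/lf !rmorphB rmorphM rmorphB /= !msubstX !msubstC r_lift r_j0.
  case: ifP => // _; set c := _%:MP; set d := _ * (_ - _).
  have -> : lf k = 'X_(lift j0 k) - (c + d) by rewrite opprD addrA.
  by rewrite opprB addrCA subrr addr0 -addrA -opprD subrr.
have ker_r i (b : {mpoly K[n'.+1]}^o) :
    (b \in ideal_smul (M := {mpoly K[n'.+1]}^o) (take i l)) = (msubst (r i) b == 0).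
  apply: msubst_ker => [x /mem_takeP[k lt_ki ->]|j]; first by rewrite r_lf lt_ki.
  case: (unliftP j0 j) => [k|] ->; last by rewrite r_j0 subrr; exact: rpred0.
  rewrite r_lift; case: ifP => [lt_ki|_]; last by rewrite subrr; exact: rpred0.
  rewrite opprB addrCA subrr addr0 -[lf k]mulr1.
  by apply: (@mem_ideal_smul _ {mpoly K[n'.+1]}^o); apply: mem_take.
exists l; split=> // [x|i b|i b lt_in].
- case/mapP => k _ ->; rewrite /lf !mevalB mevalM mevalB !mevalXU !mevalC.
  by rewrite !subrr mulr0 subr0.
- rewrite !ker_r -[J *: b]/(J * b : {mpoly K[n'.+1]}) rmorphM /= mulf_eq0 => /orP[/eqP rJ0|//].
  case/eqP: Jz; move/(congr1 (meval z)): rJ0; rewrite meval0 msubst_meval => <-.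
  apply: meval_eq => j; case: (unliftP j0 j) => [k|] ->; last by rewrite r_j0 mevalXU.
  rewrite r_lift; case: ifP => _; last by rewrite mevalXU.
  rewrite mevalB mevalXU /lf !mevalB mevalM mevalB !mevalXU !mevalC /slope divfK // subrr.
  by rewrite subr0.
- rewrite !ker_r (nth_l (Ordinal lt_in)) -[_ *: b]/(lf (Ordinal lt_in) * b : {mpoly K[n'.+1]}).
  rewrite rmorphM /= r_lf /= ltnn mulf_eq0 => /orP[/eqP lf0|//].
  have /(congr1 (mcoeff U_(lift j0 (Ordinal lt_in)))) := lf0.
  rewrite /lf !mcoeffB mul_mpolyC mcoeffZ mcoeffB !mcoeffXU !mcoeffC !mnm1_eq0 eqxx.
  rewrite (negPf (neq_lift _ _)). rewrite !mulr0 !subr0 mulr0 subr0.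
  by move/eqP; rewrite oner_eq0.
Qed.

End LinearSections.

(** * Points of the Jacobian hypersurface *)

Section FixedPoint.
Variables (K : fieldType) (n : nat) (gT : finGroupType).
Variable rG : mx_representation K [set: gT] n.
Local Notation S := {mpoly K[n]}.
Variable f : n.-tuple S.
Hypothesis fP : basic_invariants rG f.

(** On the curve (1, t, ..., t^(n-1)) a nonzero linear form becomes a nonzero polynomial in t, so
    some natural number t avoids the roots of all the forms. *)
Lemma jacobian_nonvanishing : injective (fun k => k%:R : K) ->
  exists z, (jacobian f).@[z] != 0.
Proof.
move=> natK; have [s [w [s0 sE]]] := jacobian_dvd_linear_forms fP.
pose q (a : 'rV[K]_n) : {poly K} := \sum_(k < n) a 0 k *: 'X^k.
pose Q := \prod_(a <- s) q a; have nz_Q : Q != 0.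
  rewrite prodf_seq_neq0; apply/allP => a /s0 /rV0Pn[k ak] /=.
  apply: contra_neq ak => /polyP/(_ k); rewrite coef_sum coef0 (bigD1 k) //=.
  rewrite coefZ coefXn eqxx mulr1 big1 ?addr0 // => i ik.
  by rewrite coefZ coefXn eq_sym (inj_eq val_inj) (negPf ik) mulr0.
have [t Qt] : exists t, Q.[t] != 0.
  apply/not_existsP => Q0; have := max_poly_roots (rs := mkseq (fun k => k%:R) (size Q)) nz_Q.
  rewrite size_mkseq ltnn mkseq_uniq // => h; suff: false by []; apply: h => //.
  by apply/allP => _ /mapP[k _ ->]; apply/rootP/eqP/negPn/negP/Q0.
exists (fun k => t ^+ k); apply: contraNneq Qt => Jt.
have /(congr1 (meval (fun k : 'I_n => t ^+ k))) := sE.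
rewrite mevalM Jt mulr0 rmorph_prod /= => <-; rewrite /Q horner_prod; apply/eqP.
apply: eq_bigr => a _; rewrite /q /linear_form horner_sum rmorph_sum.
by apply: eq_bigr => k _; rewrite hornerZ hornerXn /= mevalZ mevalXU.
Qed.

(* If v had trivial stabilizer, averaging p^2 (x_k - v_k), where p vanishes on the
   rest of the orbit of v, would give invariants with independent differentials. *)
Lemma jacobian_zero_fixed v : (jacobian f).@[v] = 0 ->
  exists2 g, g != 1%g & forall j, \sum_k rG g k j * v k = v j.
Proof.
move=> Jv; pose gv g j := \sum_k rG g k j * v k.
apply: contrapT => nfix; have /choice[l lP] g : exists l : S,
    g != 1%g -> l.@[v] != 0 /\ l.@[gv g] = 0.
  have [->|g1] := eqVneq g 1%g; first by exists 0.
  suff [j gvj] : exists j, gv g j != v j.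
    exists ('X_j - (gv g j)%:MP) => _; rewrite !mevalB !mevalXU !mevalC subrr.
    by rewrite subr_eq0 eq_sym.
  apply: contrapT => fix_g; apply: nfix; exists g => // j; apply/eqP/negPn/negP => gvj.
  by apply: fix_g; exists j.
pose p := \prod_(g | g != 1%g) l g.
have pv : p.@[v] != 0.
  rewrite /p rmorph_prod /=; apply/prodf_neq0 => g g1.
  by have [] := lP g g1.
have pgv g : g != 1%g -> p.@[gv g] = 0.
  by move=> g1; rewrite /p rmorph_prod (bigD1 g) //= (proj2 (lP g g1)) mul0r.
(* With p squared, the terms for g <> 1 vanish to second order at v, so their derivatives vanish
   there too. *)
pose r k := \sum_g Sact rG g (p * (p * ('X_k - (v k)%:MP))).
have dr k j : ((r k)^`M(j)).@[v] = p.@[v] ^+ 2 * (k == j)%:R.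
  rewrite /r (raddf_sum (mderiv j)) (raddf_sum (meval v)) (bigD1 1%g) //=.
  rewrite Sact1 !mderivM mderivB mderivXU mderivC subr0 big1 ?addr0 => [|g g1].
    rewrite !(mevalD, mevalM, mevalN) mevalXU mevalC subrr !mulr0 !add0r rmorph_nat.
    by rewrite mulrA.
  rewrite Sact_mul Sact_mul !mderivM !(mevalD, mevalM) !meval_Sact pgv //.
  by rewrite !mul0r mulr0 add0r.
have /choice[A AP] k :=
  Sinvariant_mderiv fP (Sinvariant_sum_Sact rG (p * (p * ('X_k - (v k)%:MP)))).
have : \det (\matrix_(k, j) (r k)^`M(j)) = \det (\matrix_(k, i) A k i) * jacobian f.
  rewrite -det_mulmx; congr (\det _); apply/matrixP => k j; rewrite !mxE AP.
  by apply: eq_bigr => i _; rewrite !mxE.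
move/(congr1 (meval v)); rewrite mevalM Jv mulr0 -(det_map_mx (meval v)).
have -> : map_mx (meval v) (\matrix_(k, j) (r k)^`M(j)) = (p.@[v] ^+ 2)%:M.
  apply/matrixP => k j; rewrite !mxE; apply: etrans (dr k j) _.
  by rewrite mulr_natr.
by rewrite det_scalar => /eqP; rewrite expf_eq0 expf_eq0 (negPf pv) !andbF.
Qed.

End FixedPoint.

(** * Maximal ideals over an uncountable algebraically closed field *)

Section Nullstellensatz.
Variables (K : closedFieldType) (n : nat).
Local Notation S := {mpoly K[n]}.
Hypothesis uncountableK : forall F : nat -> seq K, exists c, forall N, c \notin F N.

(* Uncountability bounds the degrees of infinitely many inverses y_c of x_j - c, and
   a linear relation between them yields a polynomial relation for x_j modulo P. *)
Lemma uncountable_fiber (d : K -> nat) :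
  exists N, forall m, exists2 s : seq K, uniq s /\ size s = m & forall c, c \in s -> d c = N.
Proof.
apply: contrapT => /forallNP nN.
(* A fibre without arbitrarily long duplicate-free lists is exhausted by one list; these lists would
   then cover K. *)
have /choice[F FP] N : exists s : seq K, forall c, d c = N -> c \in s.
  apply: contrapT => /forallNP ns; apply: (nN N); elim=> [|m [s [uniq_s size_s] sN]].
    by exists [::].
  have /existsNP[c /not_implyP[cN /negP ncs]] := ns s.
  exists (c :: s); first by rewrite /= ncs size_s.
  by move=> b; rewrite inE => /orP[/eqP ->|/sN].
have [c cF] := uncountableK F; by have := FP _ c erefl; rewrite (negPf (cF _)).
Qed.

Variable P : S -> Prop.
Hypotheses (idealP : is_ideal P) (nP1 : ~ P 1)
  (invP : forall a, ~ P a -> exists b, P (1 - a * b)).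

Let PD a b : P a -> P b -> P (a + b).
Proof. by rewrite -{2}[a]mul1r; apply: (proj2 idealP). Qed.

Let PM a b : P b -> P (a * b).
Proof.
by move=> Pb; rewrite -[_ * _]addr0; apply: (proj2 idealP) => //; apply: (proj1 idealP).
Qed.

Let Pprime a b : P (a * b) -> P a \/ P b.
Proof.
move=> Pab; have [|nPa] := pselect (P a); first by left.
right; have [a' Pa'] := invP nPa.
have -> : b = b * (1 - a * a') + a' * (a * b).
  by rewrite mulrBr mulr1 [a' * _]mulrC -[X in _ + X]mulrA mulrCA [b * a']mulrC subrK.
by apply: PD; apply: PM.
Qed.

Lemma var_mod_maximal_ideal j : exists c, P ('X_j - c%:MP).
Proof.
apply: contrapT => /forallNP nPj.
have /choice[y yP] c := invP (nPj c).
have [N fiberN] := uncountable_fiber (fun c => msize (y c)).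
pose F : finType := 'X_{1..n < N}.
(* One more inverse than there are monomials of degree below N forces a linear relation. *)
have [s [uniq_s size_s] sN] := fiberN #|F|.+1.
pose x (i : 'I_#|F|.+1) := s`_i.
have xs i : x i \in s by rewrite mem_nth // size_s.
have x_inj : injective x.
  by move=> i k /eqP; rewrite nth_uniq ?size_s // => /eqP/val_inj.
pose C : 'M[K]_(#|F|.+1, #|F|) := \matrix_(i, k) (y (x i))@_(bmnm (enum_val k)).
have : kermx C != 0.
  by rewrite kermx_eq0 -row_leq_rank -ltnNge ltnS rank_leq_col.
case/rowV0Pn => u /sub_kermxP uC nz_u.
have uy0 : \sum_i u 0 i *: y (x i) = 0.
  apply/mpolyP => m; rewrite mcoeff0 (raddf_sum (mcoeff m)) /=.
  have [lt_mN|le_Nm] := ltnP (mdeg m) N; last first.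
    rewrite big1 // => i _; rewrite mcoeffZ memN_msupp_eq0 ?mulr0 //.
    by apply: msize_mdeg_ge; rewrite sN.
  pose k : F := BMultinom lt_mN.
  have /rowP/(_ (enum_rank k)) := uC; rewrite !mxE => {2}<-.
  by apply: eq_bigr => i _; rewrite mcoeffZ mxE enum_rankK.
(* This is the relation sum u_i / (X - x_i) = 0 with denominators cleared. Its value at x_i is u_i
   times a nonzero product, so [Q] is not zero. *)
pose Q : {poly K} := \sum_i u 0 i *: \prod_(k | k != i) ('X - (x k)%:P).
have nz_Q : Q != 0.
  have /rV0Pn[i ui] := nz_u; apply: contra_neq ui => /(congr1 (horner^~ (x i))).
  rewrite /Q horner0 horner_sum (bigD1 i) //= [X in _ + X]big1 => [|k ki].
    rewrite addr0 hornerZ horner_prod => /eqP; rewrite mulf_eq0 prodf_seq_eq0.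
    case/orP => [/eqP //|/hasP[k _ /andP[ki]]]; rewrite hornerXsubC subr_eq0.
    by rewrite (inj_eq x_inj) eq_sym (negPf ki).
  by rewrite hornerZ horner_prod (bigD1 i) 1?eq_sym //= hornerXsubC subrr mul0r mulr0.
pose ev (q : {poly K}) : S := (map_poly (@mpolyC n K) q).['X_j].
have evXC c : ev ('X - c%:P) = 'X_j - c%:MP.
  by rewrite /ev rmorphB /= map_polyX map_polyC hornerXsubC.
have evM : {morph ev : p q / p * q} by move=> p q; rewrite /ev rmorphM hornerM.
have ev_prod (I : Type) (r : seq I) (p : pred I) (G : I -> {poly K}) :
    ev (\prod_(i <- r | p i) G i) = \prod_(i <- r | p i) ev (G i).
  apply: (big_morph ev evM); by rewrite /ev rmorph1 hornerC.
have PQ : P (ev Q).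
  have -> : ev Q = \sum_i (u 0 i)%:MP * \prod_(k | k != i) ('X_j - (x k)%:MP).
    rewrite /ev /Q rmorph_sum horner_sum; apply: eq_bigr => i _ /=.
    rewrite map_polyZ hornerZ; congr (_ * _); rewrite -[LHS]/(ev _) ev_prod.
    by apply: eq_bigr => k _.
  (* The added factors only subtract the full product times sum u_i y_i = 0, and they make every
     summand visibly lie in P. *)
  have -> : \sum_i (u 0 i)%:MP * \prod_(k | k != i) ('X_j - (x k)%:MP) =
      \sum_i (u 0 i)%:MP * \prod_(k | k != i) ('X_j - (x k)%:MP) *
        (1 - ('X_j - (x i)%:MP) * y (x i)).
    under [RHS]eq_bigr => i _ do rewrite mulrBr mulr1.
    rewrite sumrB [X in _ - X](_ : _ = 0) ?subr0 //.
    transitivity (\prod_k ('X_j - (x k)%:MP) * \sum_i u 0 i *: y (x i)).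
      rewrite mulr_sumr; apply: eq_bigr => i _; rewrite [in RHS](bigD1 i) //=.
      rewrite -mul_mpolyC; set b := _ - _; set c := \prod_(k | k != i) _.
      by rewrite [_ * c]mulrC mulrACA [c * b]mulrC.
    by rewrite uy0 mulr0.
  apply: (big_ind P) => [||i _]; [exact: (proj1 idealP) | exact: PD |].
  by apply: PM; apply: yP.
have [rs QE] := closed_field_poly_normal Q.
move: PQ; rewrite QE; have -> : ev (lead_coef Q *: \prod_(z <- rs) ('X - z%:P)) =
    (lead_coef Q)%:MP * \prod_(z <- rs) ('X_j - z%:MP).
  rewrite /ev map_polyZ hornerZ; congr (_ * _); rewrite -[LHS]/(ev _) ev_prod.
  by apply: eq_bigr => k _.
case/Pprime => [Plead|].
  apply: nP1; rewrite -(mpolyC1 n K) -(mulVf (_ : lead_coef Q != 0)) ?lead_coef_eq0 //.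
  by rewrite mpolyCM; apply: PM.
elim: rs {QE} => [|z rs IHrs]; first by rewrite big_nil.
by rewrite big_cons => /Pprime[/nPj|].
Qed.

Lemma weak_nullstellensatz : exists v, forall p, P p <-> p.@[v] = 0.
Proof.
have /choice[v vP] := var_mod_maximal_ideal; exists v.
have Pp p : P (p - (p.@[v])%:MP).
  apply: (mpoly_congr (h1 := idfun) (h2 := @mpolyC n K \o meval v) idealP) => [a|j] /=.
    by rewrite mevalC.
  by rewrite mevalXU.
move=> p; split=> [Ppp|pv]; last by have := Pp p; rewrite pv mpolyC0 subr0.
apply/eqP/negPn/negP => nz_pv; apply: nP1.
have -> : 1 = ((p.@[v])^-1)%:MP * (p - (p - (p.@[v])%:MP)) :> S.
  by rewrite opprB addrC subrK -mpolyCM mulVf // mpolyC1.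
by apply: PM; apply: PD => //; rewrite -mulN1r; apply: PM.
Qed.

End Nullstellensatz.

(** * Maximal Cohen-Macaulay cokernels *)

Section AnnihilatedModule.
Variables (B : comPzRingType) (w : B) (N : lmodType B).
Hypothesis annih : forall x : N, w *: x = 0.
Local Notation Q := (quotring (fun a : B => a = w)).
Local Notation pi a := (quotring_pi (fun b : B => b = w) a : Q).

Lemma quotring_pi_eq (a b : B) : pi a = pi b -> exists c, a - b = c * w.
Proof.
move/quotmod_eqP/submod_genP => [s [Xs ->]].
elim: s Xs => [|c s IHs] Xs; first by exists 0; rewrite big_nil mul0r.
have [|d dE] := IHs; first by move=> e es; apply: Xs; rewrite inE es orbT.
by exists (c.1 + d); rewrite big_cons dE mulrDl (Xs c (mem_head _ _)).
Qed.

Lemma quotring_pi_w : pi w = 0.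
Proof.
apply: etrans (_ : pi 0 = 0); last exact: raddf0.
by apply/quotmod_eqP; rewrite subr0; apply: mem_submod_gen.
Qed.

(** A copy of N to carry the B/(w)-module structure; the proof is a parameter because the module
    laws depend on it. *)
Definition annihilated_mod (_ : forall x : N, w *: x = 0) : Type := N.
Local Notation M := (annihilated_mod annih).

HB.instance Definition _ := GRing.Zmodule.on M.

Definition quotring_scale (a : Q) (x : M) : M := (repr a : B) *: (x : N).

Lemma quotring_scale_pi a (x : M) : quotring_scale (pi a) x = a *: (x : N).
Proof.
apply/eqP; rewrite -subr_eq0 -scalerBl; apply/eqP.
have [|c ->] := @quotring_pi_eq (repr (pi a)) a; first exact: quotring_piK.
by rewrite -scalerA annih scaler0.
Qed.

Lemma quotring_scaleA a b x :
  quotring_scale a (quotring_scale b x) = quotring_scale (a * b) x.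
Proof.
rewrite -[a]quotring_piK -[b]quotring_piK.
have -> : pi (repr a) * pi (repr b) = pi (repr a * repr b) by apply: quotring_mul_pi.
by rewrite !quotring_scale_pi scalerA.
Qed.

Lemma quotring_scale1 : left_id 1 quotring_scale.
Proof. by move=> x; apply: etrans (quotring_scale_pi 1 x) (scale1r _). Qed.

Lemma quotring_scaleDr : right_distributive quotring_scale +%R.
Proof. by move=> a x y; apply: scalerDr. Qed.

Lemma quotring_scaleDl x : {morph quotring_scale^~ x : a b / a + b}.
Proof.
move=> a b; rewrite -[a]quotring_piK -[b]quotring_piK quotring_piD.
by rewrite !quotring_scale_pi; apply: scalerDl.
Qed.

HB.instance Definition _ := GRing.Zmodule_isLmodule.Build Q M
  quotring_scaleA quotring_scale1 quotring_scaleDr quotring_scaleDl.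

Lemma annihilated_modZ a (x : M) : pi a *: x = a *: (x : N) :> N.
Proof. exact: quotring_scale_pi. Qed.

Lemma annihilated_mod_ideal_smul (xs : seq B) (y : N) :
  ((y : M) \in ideal_smul (M := M) [seq pi x | x <- xs]) =
    (y \in ideal_smul (M := N) xs).
Proof.
apply/idP/idP => /submod_genP[s [Xs ->]]; rewrite big_seq.
  apply: (big_ind (fun z : N => z \in ideal_smul (M := N) xs)); first exact: rpred0.
    by move=> z z'; apply: rpredD.
  move=> c /Xs[_ /mapP[x xs_x ->] [z ->]].
  by rewrite -[c.1]quotring_piK !annihilated_modZ; apply: submod_genZ; apply: mem_ideal_smul.
apply: (big_ind (fun z : M => z \in ideal_smul (M := M) [seq pi x | x <- xs])); first exact: rpred0.
  by move=> z z'; apply: rpredD.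
move=> c /Xs[x xs_x [z ->]]; rewrite -!annihilated_modZ; apply: submod_genZ.
by apply: mem_ideal_smul; apply: map_f.
Qed.

End AnnihilatedModule.

Section CokernelMaximalCohenMacaulay.
Variables (K : closedFieldType) (n : nat).
Local Notation S := {mpoly K[n]}.
Variables (J : S) (F N : lmodType S) (u : F -> N) (v : N -> F).
Hypothesis uv : matrix_factorization J u v.
Hypothesis uncountableK : forall s : nat -> seq K, exists c, forall k, c \notin s k.
Hypothesis nz_J : J != 0.
Hypothesis nonvanishing : exists z, J.@[z] != 0.
Hypothesis linear_factor : forall x, J.@[x] = 0 -> exists (a : 'rV[K]_n) j1,
  [/\ a 0 j1 != 0, (linear_form a).@[x] = 0 & msubst (hyperplane_subst a j1) J = 0].
(* chi is a nonzero map from coker u to the residue field of S at x. *)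
Hypothesis residue : forall x, J.@[x] = 0 -> exists chi : N -> K,
  [/\ forall a y z, chi (a *: y + z) = a.@[x] * chi y + chi z,
      forall y, chi (u y) = 0 & exists y, chi y != 0].

Local Notation Q := (quotring (fun a : S => a = J)).
Local Notation pi a := (quotring_pi (fun b : S => b = J) a : Q).
Local Notation C := (coker u).
Local Notation M := (annihilated_mod (coker_annihilated uv)).

Let piM a b : pi (a * b) = pi a * pi b. Proof. exact: esym (quotring_mul_pi _ _ _). Qed.
Let piD a b : pi (a + b) = pi a + pi b. Proof. exact: esym (quotring_piD _ _ _). Qed.

Lemma annihilated_coker_finitely_generated : finitely_generated M.
Proof.
have [[_ [r [b freeN]]] _] := uv.
exists [seq (\pi_(coker u) (b i) : M) | i <- enum 'I_r] => x.
have [c [xE _]] := freeN (repr (x : C)).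
have -> : x = \sum_i pi (c i) *: (\pi_(coker u) (b i) : M) :> M.
  rewrite -[LHS](reprK (x : C)) xE.
  elim: (index_enum _) => [|i s IHs]; first by rewrite !big_nil; exact: raddf0.
  rewrite !big_cons -IHs; apply: etrans (@quotmod_pi_linear _ _ _ _ _ _) _.
  by congr (_ + _); rewrite annihilated_modZ.
apply: rpred_sum => i _; apply: submod_genZ; apply: mem_submod_gen.
by apply: map_f; rewrite mem_enum.
Qed.

Section AtMaximalIdeal.
Variable P : Q -> Prop.
Hypothesis maxP : maximal_ideal P.

Lemma maximal_ideal_point : exists x, forall a, P (pi a) <-> a.@[x] = 0.
Proof.
have [[P0 Plin] nP1 maxI] := maxP.
have PD a b : P a -> P b -> P (a + b) by rewrite -{2}[a]mul1r; apply: Plin.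
have PM a b : P b -> P (a * b) by move=> Pb; rewrite -[_ * _]addr0; apply: Plin.
apply: (weak_nullstellensatz uncountableK (P := fun a => P (pi a))) => [||a nPa].
- split=> [|a b c Pb Pc]; last by rewrite piD piM; apply: Plin.
  by have -> : pi 0 = 0 by exact: raddf0.
- exact: nP1.
(* The ideal P + (a): by maximality it contains 1, which makes a invertible modulo P. *)
pose I x := exists b, P (x - b * pi a).
have [b Pb] : I 1.
  apply: contrapT => nI1; apply: nPa; apply: (maxI I) => //.
  - split; first by exists 0; rewrite mul0r subrr.
    move=> c y z [d Pd] [e Pe]; exists (c * d + e).
    have -> : c * y + z - (c * d + e) * pi a = c * (y - d * pi a) + (z - e * pi a).
      by rewrite mulrDl opprD addrACA mulrBr mulrA.
    exact: Plin.
  - by move=> y Py; exists 0; rewrite mul0r subr0.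
  - by exists 1; rewrite mul1r subrr.
exists (repr b); suff -> : pi (1 - a * repr b) = 1 - b * pi a by [].
rewrite -[in RHS](quotring_piK b) -piM mulrC.
by apply: esym; apply: etrans (esym (raddfB _ _ _)).
Qed.

Lemma maximal_ideal_prime : ~ P 1 /\ forall a b, ~ P a -> ~ P b -> ~ P (a * b).
Proof.
have [x Px] := maximal_ideal_point; split; first by case: maxP.
move=> a b; rewrite -[a]quotring_piK -[b]quotring_piK -piM !Px mevalM.
by move=> /eqP nz_a /eqP nz_b; apply/eqP; rewrite mulf_neq0.
Qed.

Let mem_loc_linear xs a (y z : M) :
  mem_loc P (ideal_smul (M := M) xs) y -> mem_loc P (ideal_smul (M := M) xs) z ->
  mem_loc P (ideal_smul (M := M) xs) (a *: y + z).
Proof.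
case=> s nPs Iy [t nPt Iz]; exists (s * t); first exact: (proj2 maximal_ideal_prime).
rewrite scalerDr rpredD //; last by rewrite -scalerA rpredZ.
by rewrite scalerA mulrAC mulrC -!scalerA rpredZ // scalerA mulrC -scalerA rpredZ.
Qed.

Lemma annihilated_coker_depth_bound xs : regular_at P M xs -> (size xs < n)%N.
Proof.
case=> xsP reg [y ny]; rewrite ltnNge; apply/negP => le_n; apply: ny.
suff [t nPt It] : mem_loc P (ideal_smul (M := M) (take n xs)) y.
  by exists t => //; apply: ideal_smulS It => a; apply: mem_take.
pose x : seq S := map repr (take n xs).
have size_x : size x = n by rewrite size_map size_takel.
have x_nth i : (i < n)%N -> pi x`_i = xs`_i.
  move=> lt_in; rewrite (nth_map 0) ?size_takel // nth_take //.
  exact: quotring_piK.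
apply: (@regular_tower_size_bound K n C J x
  (fun i (z : C) => mem_loc P (ideal_smul (M := M) (take i xs)) (z : M)) y nz_J size_x).
- move=> i a z z' Tz Tz'; have := @mem_loc_linear (take i xs) (pi a) z z' Tz Tz'.
  by rewrite annihilated_modZ.
- rewrite size_x => i lt_in; have nP1 := proj1 maximal_ideal_prime.
  have xz (z : C) : x`_i *: z = (xs`_i *: (z : M) : M).
    by rewrite -(x_nth i lt_in); exact: esym (@annihilated_modZ _ _ _ (coker_annihilated uv) x`_i z).
  split=> z; rewrite ?xz.
  + by apply: (reg i); apply: leq_trans lt_in le_n.
  + case=> t nPt It; exists t => //; apply: ideal_smulS It => a.
    by rewrite (take_nth 0) ?(leq_trans lt_in le_n) // mem_rcons inE orbC => ->.
  + exists 1 => //; rewrite scale1r; apply: mem_ideal_smul.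
    by rewrite (take_nth 0) ?(leq_trans lt_in le_n) // mem_rcons mem_head.
- move=> z; rewrite (coker_annihilated uv); exists 1; first exact: (proj1 maximal_ideal_prime).
  by rewrite scaler0 rpred0.
Qed.

Lemma quotring_dim_bound : ~ prime_chain_in P n.
Proof.
case=> q [primeq chain _].
apply: (@prime_chain_bound K n J (fun i a => q i (pi a)) nz_J).
- move=> i /primeq[[q0 qlin] nq1 qpr]; split=> //.
  + split=> [|a b c]; last by rewrite piD piM; apply: qlin.
    by have -> : pi 0 = 0 by exact: raddf0.
  + by move=> a b; rewrite piM; apply: qpr.
- move=> i /chain[sub [a qa nqa]]; split=> [b|]; first exact: sub.
  by exists (repr a); rewrite quotring_piK.
- by rewrite quotring_pi_w; have [[q0 _] _ _] := primeq 0%N (leq0n _).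
Qed.

Lemma quotring_prime_chain x (a : 'rV[K]_n) j1 :
  (forall b, P (pi b) <-> b.@[x] = 0) -> a 0 j1 != 0 -> (linear_form a).@[x] = 0 ->
  msubst (hyperplane_subst a j1) J = 0 -> prime_chain_in P n.-1.
Proof.
move=> Px nz_a ax J0.
have [p [primep chain p0J pn]] := hyperplane_prime_chain nz_a ax J0.
have pJ i : (i <= n.-1)%N -> p i J.
  by elim: i => [|i IHi] // lt_i; have [sub _] := chain i lt_i; apply: sub; apply: IHi; apply: ltnW.
(* All primes of the chain contain J, so membership does not depend on the representative. *)
have q_pi i b : (i <= n.-1)%N -> p i (repr (pi b)) <-> p i b.
  move=> le_i; have [[_ plin] _ _] := primep i.
  have [c E] := quotring_pi_eq (quotring_piK (pi b)).
  have -> : repr (pi b) = c * J + b by rewrite -E subrK.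
  split=> pb; last by apply: plin => //; apply: pJ.
  by have := plin (- c) J _ (pJ i le_i) pb; rewrite addrA -mulrDl addNr mul0r add0r.
exists (fun i b => p i (repr b)); split.
- move=> i le_i; have [[p0 plin] np1 ppr] := primep i; split; first split.
  + by have := (q_pi i 0 le_i).2 p0; have -> : pi 0 = 0 by exact: raddf0.
  + move=> b c d pc pd; rewrite -[b]quotring_piK -[c]quotring_piK -[d]quotring_piK.
    by rewrite -piM -piD; apply/q_pi => //; apply: plin.
  + by move=> p1; apply: np1; apply/(q_pi i 1 le_i).
  + move=> b c; rewrite -{1}[b]quotring_piK -{1}[c]quotring_piK -piM => /q_pi pbc.
    exact: ppr (pbc le_i).
- move=> i lt_i; have [sub [b pb npb]] := chain i lt_i; split=> [c|]; first exact: sub.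
  exists (pi b); first by apply/q_pi.
  by move/(q_pi i b (ltnW lt_i)).
- by move=> b /pn; rewrite -Px quotring_piK.
Qed.

Lemma annihilated_coker_regular_sequence x : J.@[x] = 0 ->
  (forall b, P (pi b) <-> b.@[x] = 0) ->
  exists2 xs, regular_at P M xs & size xs = n.-1.
Proof.
move=> Jx Px; have [z Jz] := nonvanishing.
have [l [size_l lx regJ regl]] := line_regular_sequence Jx Jz.
exists [seq pi b | b <- l]; last by rewrite size_map.
split=> [_ /mapP[b /lx bx ->]|i|]; first by apply/Px.
  rewrite size_map => lt_i y [t nPt]; rewrite -map_take (nth_map 0) // => It.
  (* The denominator t is moved onto y, which leaves regularity without localization. *)
  exists t => //; move: It; rewrite scalerA mulrC -scalerA annihilated_modZ.
  rewrite !annihilated_mod_ideal_smul; move: (t *: y) => {}y.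
  apply: (coker_regular uv); last by move=> b; apply: regl; rewrite -size_l.
  by move=> b; rewrite -(take_nth 0 lt_i); apply: regJ.
(* chi kills the image of u and all multiples of the forms, which vanish at x, but not t y for t
   outside P; so y survives in the localized quotient. *)
have [chi [chi_lin chi_u [y chi_y]]] := residue Jx.
exists (\pi_(coker u) y : C) => -[t nPt].
rewrite -[t]quotring_piK annihilated_modZ annihilated_mod_ideal_smul.
case/ideal_smul_quotmod => s Is sE.
have chi0 : chi 0 = 0.
  have E := chi_lin 1 0 0; rewrite scaler0 addr0 meval1 mul1r in E.
  by apply: (addrI (chi 0)); rewrite -E addr0.
have chis : chi s = 0.
  case/submod_genP: Is => r [Xr ->]; elim: r Xr => [|c r IHr] Xr; first by rewrite big_nil.
  rewrite big_cons chi_lin IHr ?addr0 => [|d dr]; last by apply: Xr; rewrite inE dr orbT.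
  have [b bl [w ->]] := Xr c (mem_head _ _).
  by rewrite -[b *: w]addr0 chi_lin chi0 addr0 (lx _ bl) mul0r mulr0.
have [w sw] := coker_eqP uv (etrans sE (quotmod_scale_pi _ (repr t) y)).
have : chi s = (repr t).@[x] * chi y.
  by rewrite -[s](subrK (repr t *: y)) sw addrC chi_lin chi_u addr0.
rewrite chis => /esym/eqP; rewrite mulf_eq0 (negPf chi_y) orbF => /eqP /Px.
by rewrite quotring_piK.
Qed.

End AtMaximalIdeal.

Lemma annihilated_coker_maximal_Cohen_Macaulay : maximal_Cohen_Macaulay M.
Proof.
split; first exact: annihilated_coker_finitely_generated.
move=> P maxP; have [x Px] := maximal_ideal_point maxP.
have Jx : J.@[x] = 0 by apply/Px; rewrite quotring_pi_w; case: maxP => -[].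
have [a [j1 [nz_a ax J0]]] := linear_factor Jx.
(* Positivity makes [n.-1] a true predecessor, as the bounds are stated for n. *)
have n_gt0 : (0 < n)%N by apply: leq_ltn_trans (ltn_ord j1).
exists n.-1; split.
- exact: quotring_prime_chain Px nz_a ax J0.
- by rewrite prednK //; apply: quotring_dim_bound.
- exact: annihilated_coker_regular_sequence Jx Px.
- by move=> xs /(annihilated_coker_depth_bound maxP) lt_n; rewrite -ltnS prednK.
Qed.

End CokernelMaximalCohenMacaulay.

(** * Complex reflection groups *)

Section ComplexUncountable.
Import Order.TTheory Num.Theory.
Variable R : realType.

(** For each point, pass to a subinterval strictly on one side of it: [a, m] if it lies right of the
    midpoint m, otherwise the right half of [m, b]. *)
Lemma interval_avoid (s : seq R) (a b : R) : a < b -> exists a' b',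
  [/\ a <= a', a' < b', b' <= b & forall x, x \in s -> ~~ (a' <= x <= b')].
Proof.
elim: s a b => [|x s IHs] a b lt_ab; first by exists a, b.
have [c1 [c2 [ac1 c12 c2b xc]]] : exists c1 c2,
    [/\ a <= c1, c1 < c2, c2 <= b & ~~ (c1 <= x <= c2)].
  have lt_am : a < (a + b) / 2 by apply: (midf_lt lt_ab).1.
  have lt_mb : (a + b) / 2 < b by apply: (midf_lt lt_ab).2.
  set m := (a + b) / 2 in lt_am lt_mb.
  have [le_xm|lt_mx] := leP x m; last first.
    by exists a, m; split=> //; [exact: ltW|rewrite [x <= m]leNgt lt_mx andbF].
  exists ((m + b) / 2), b; split=> //.
  - by apply: ltW; apply: lt_trans lt_am _; apply: (midf_lt lt_mb).1.
  - exact: (midf_lt lt_mb).2.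
  - by rewrite leNgt (le_lt_trans le_xm) // (midf_lt lt_mb).1.
have [a' [b' [ca ab bc avoid]]] := IHs c1 c2 c12.
exists a', b'; split=> //; [exact: le_trans ca | exact: le_trans c2b |].
move=> y; rewrite inE => /orP[/eqP ->|/avoid //].
apply: contra xc => /andP[ay yb]; by rewrite (le_trans ca ay) (le_trans yb bc).
Qed.

(** Cantor's nested intervals: interval k + 1 avoids the list [s k], and the supremum of the left
    endpoints lies in all intervals. *)
Lemma real_uncountable (s : nat -> seq R) : exists c, forall k, c \notin s k.
Proof.
have /choice[g gP] (I : seq R * (R * R)) : exists J : R * R, I.2.1 < I.2.2 ->
    [/\ I.2.1 <= J.1, J.1 < J.2, J.2 <= I.2.2 & forall x, x \in I.1 -> ~~ (J.1 <= x <= J.2)].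
  have [lt_I|le_I] := ltP I.2.1 I.2.2; last by exists (0, 0).
  have [a [b abP]] := interval_avoid I.1 lt_I; by exists (a, b).
pose I := fix I k := if k is k'.+1 then g (s k', I k') else (0, 1) : R * R.
have I_lt k : (I k).1 < (I k).2.
  by elim: k => [|k IHk]; [exact: ltr01 | have [] := gP (s k, I k) IHk].
have I_step k := gP (s k, I k) (I_lt k).
have I_mono k l : (I k).1 <= (I (l + k)%N).1 /\ (I (l + k)%N).2 <= (I k).2.
  elim: l => [|l [IH1 IH2]] //; have [le1 _ le2 _] := I_step (l + k)%N.
  by split; [exact: le_trans le1 | exact: le_trans IH2].
have I_cross k l : (I k).1 <= (I l).2.
  have [le1 _] := I_mono k l; have [_ le2] := I_mono l k.
  by rewrite addnC in le2; apply: le_trans le1 (le_trans (ltW (I_lt _)) le2).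
pose A : classical_sets.set R := fun x => exists k, x = (I k).1.
have ubA l : classical_sets.ubound A (I l).2 by move=> _ [k ->].
have A1 k : A (I k).1 by exists k.
exists (sup A) => k; have [_ _ _ avoid] := I_step k; apply/negP => /avoid/negP; apply.
rewrite -[g _]/(I k.+1); apply/andP; split; first by apply: (ub_le_sup _ (A1 k.+1)); exists (I 0%N).2.
by apply: ge_sup; [exists (I 0%N).1 | exact: ubA].
Qed.

Lemma complex_uncountable (s : nat -> seq R[i]) : exists c, forall k, c \notin s k.
Proof.
have [c cP] := real_uncountable (fun k => map (@complex.Re R) (s k)).
exists (Complex c 0) => k; apply: contra (cP k) => /(map_f (@complex.Re R)).
by [].
Qed.

Lemma complex_natr_inj : injective (fun k => k%:R : R[i]).
Proof. by move=> k l /eqP; rewrite eqr_nat => /eqP. Qed.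

End ComplexUncountable.

Section Residue.
Variables (K : fieldType) (n : nat) (gT : finGroupType).
Variable rG : mx_representation K [set: gT] n.
Local Notation S := {mpoly K[n]}.

(* The components of phi x at 1 and g agree at v, so phi is not surjective there. *)
Lemma phi_residue (v : 'I_n -> K) g : g != 1%g ->
  (forall j, \sum_k rG g k j * v k = v j) ->
  exists chi : Maps K n gT -> K,
    [/\ forall a s t, chi (a *: s + t) = a.@[v] * chi s + chi t,
        forall x : SRS rG, chi (phi x) = 0 & exists s, chi s != 0].
Proof.
move=> g1 fix_v; exists (fun s => (s g : S).@[v] - (s 1%g : S).@[v]); split.
- move=> a s t; rewrite !MapsE !mevalD !mevalM mulrBr opprD addrACA.
  by [].
- move=> x; rewrite -[x]reprK !phi_pi; apply/eqP; rewrite subr_eq0; apply/eqP.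
  apply: (mpoly_rmorph_ext (h1 := meval v \o phiK rG g)
    (h2 := meval v \o phiK rG 1%g)) => [a|j] /=; first by rewrite !phiKC.
  rewrite !phiKX -[Sact_var rG 1%g j]SactX Sact1 mevalXU -[RHS]fix_v.
  rewrite /Sact_var (raddf_sum (meval v)); apply: eq_bigr => k _ /=.
  by rewrite mevalZ mevalXU.
- exists [ffun h => (h == 1%g)%:R]; rewrite !ffunE eqxx (negPf g1) meval0 meval1.
  by rewrite sub0r oppr_eq0 oner_eq0.
Qed.

End Residue.

Theorem corollary3p18 (R : realType) (n : nat) (gT : finGroupType)
    (rG : mx_representation R[i] [set: gT] n)
    (f : n.-tuple {mpoly R[i][n]})
    (nabla : 'I_n -> 'I_n -> {mpoly {mpoly R[i][n]}[n]}) :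
  mx_faithful rG ->
  generated_by_pseudo_reflections rG ->
  basic_invariants rG f ->
  divided_differences f nabla ->
  let J := jacobian f in
  [/\ linear (psi rG nabla),
      forall (s : Maps R[i] n gT) (g : gT),
        phi (psi rG nabla s) g = Sact rG g J * s g,
      matrix_factorization J (@phi _ _ _ rG) (psi_det rG nabla),
      isomorphic_modules (coker (@phi _ _ _ rG)) (skew_bar rG)
    & exists (M : lmodType (quotring (fun a => a = J))) (h : skew_bar rG -> M),
        [/\ bijective h,
            forall a x y, h (a *: x + y) = quotring_pi (fun b => b = J) a *: h x + h y
          & maximal_Cohen_Macaulay M]].
Proof.
move=> faith genG fP nablaP J.
have natK := @complex_natr_inj R.
have charK : #|gT|%:R != 0 :> R[i].
  apply/eqP => /(natK #|gT| 0%N) card0.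
  by have /card_gt0P : exists g, g \in gT; [exists 1%g | rewrite card0].
have invf i : Sinvariant rG (tnth f i) by case: fP.
have mf := phi_psi_matrix_factorization fP genG charK faith nablaP.
have iso := coker_phi_isomorphic rG charK.
split=> //; [exact: psi_linear | exact: phi_psi |].
have [u lin_u [h uK hK]] := iso.
(* M is the cokernel of phi with its induced S/(J)-action, reached by the inverse of the
   isomorphism. *)
exists (annihilated_mod (coker_annihilated mf)), h; split.
- by exists u.
- move=> a x y; apply: (can_inj uK); rewrite hK.
  rewrite -[X in _ = u X]/(_ : coker (@phi _ _ _ rG)).
  have -> : u (quotring_pi (fun b => b = J) a *: (h x : annihilated_mod (coker_annihilated mf)) + h y)
      = u (a *: h x + h y) by rewrite annihilated_modZ.
  by rewrite lin_u !hK.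
- apply: annihilated_coker_maximal_Cohen_Macaulay.
  + exact: complex_uncountable.
  + exact: (jacobian_neq0 fP).
  + exact: (jacobian_nonvanishing fP natK).
  + move=> v Jv; have [s [w [s0 sE]]] := jacobian_dvd_linear_forms fP.
    exact: (linear_factor_at s0 sE Jv).
  + move=> v Jv; have [g g1 fix_g] := jacobian_zero_fixed fP Jv.
    exact: (phi_residue g1 fix_g).
Qed.
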